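(* Let $M$ be a graded Lie algebra, $L$ and $A$ graded Lie subalgebras of $M$ such that $M=L\oplus A$ as graded spaces, and let $P:M\to A$ be the projection with kernel $L$. For $m\in M$ let $\Phi(m)\in\mathrm{Coder}(SA)$ be the coderivation with Taylor coefficients $\Phi(m)_0(1)=Pm$ and, for $i\ge1$, $$\Phi(m)_i(a_1\odot\cdots\odot a_i)=\sum_{\sigma\in S_i}\varepsilon(\sigma)\sum_{k=0}^{i}\frac{B_{i-k}}{k!(i-k)!}\overbrace{[\cdots[}^{i-k}P([\cdots[m,a_{\sigma(1)}]\cdots,a_{\sigma(k)}]),a_{\sigma(k+1)}]\cdots,a_{\sigma(i)}].$$ For $D\in\mathrm{Der}(M/L)$ let $\Phi(D)\in\mathrm{Coder}(\overline{S}A)$ be the coderivation with Taylor coefficients, for $i\ge1$, $$\Phi(D)_i(a_1\odot\cdots\odot a_i)=\sum_{\sigma\in S_i}\varepsilon(\sigma)\sum_{k=1}^{i}\frac{B_{i-k}}{k!(i-k)!}\overbrace{[\cdots[}^{i-k}P([\cdots[Da_{\sigma(1)},a_{\sigma(2)}]\cdots,a_{\sigma(k)}]),a_{\sigma(k+1)}]\cdots,a_{\sigma(i)}].$$ Then for every $D,D_1,D_2\in\mathrm{Der}(M/L)$ and $m,m_1,m_2\in M$ the following identities hold: $$[\Phi(m_1),\Phi(m_2)]=\Phi([m_1,m_2]),\qquad [\Phi(D_1),\Phi(D_2)]=\Phi([D_1,D_2]),\qquad [\Phi(D),\Phi(m)]=\Phi(Dm),$$ where the brackets in the left hand sides are the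 Nijenhuis–Richardson (graded commutator) brackets of coderivations.
   Context: We work over a field $\mathbb{K}$ of characteristic zero; graded means $\mathbb{Z}$-graded. $\mathrm{Der}(M)$ is the graded Lie algebra of derivations of $M$, and $\mathrm{Der}(M/L)=\{D\in\mathrm{Der}(M): D(L)\subset L\}$. $V^{\odot n}$ is the $n$-th graded symmetric power (coinvariants of $V^{\otimes n}$ with Koszul signs), $V^{\odot0}=\mathbb{K}$; $SV=\bigoplus_{n\ge0}V^{\odot n}$ and $\overline{S}V=\bigoplus_{n\ge1}V^{\odot n}$ are the symmetric and the reduced symmetric coalgebra. $\mathrm{Coder}$ denotes the graded Lie algebra of coderivations with graded commutator bracket. Corestriction gives isomorphisms $\mathrm{Coder}(SV)\cong\prod_{i\ge0}\mathrm{Hom}(V^{\odot i},V)$ and $\mathrm{Coder}(\overline{S}V)\cong\prod_{i\ge1}\mathrm{Hom}(V^{\odot i},V)$, $Q\mapsto(q_i)_i$; the $q_i$ are the Taylor coefficients of $Q$. $\mathrm{Coder}(\overline{S}V)$ is viewed as a graded Lie subalgebra of $\mathrm{Coder}(SV)$ (the coderivations with $q_0=0$). In Taylor coefficients, $[Q,R]=Q\bullet R-(-1)^{|Q||R|}R\bullet Q$ with $$(Q\bullet R)_i(v_1\odot\cdots\odot v_i)=\sum_{k=0}^i\sum_{\sigma\in S(k,i-k)}\varepsilon(\sigma)\,q_{i-k+1}(r_k(v_{\sigma(1)}\odot\cdots\odot v_{\sigma(k)})\odot v_{\sigma(k+1)}\odot\cdots\odot v_{\sigma(i)}),$$ where $S(k,i-k)$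 is the set of $(k,i-k)$-unshuffles, and $r_0(\varnothing):=r_0(1)$. $\varepsilon(\sigma)$ is the Koszul sign. Bernoulli numbers: $\frac{t}{e^t-1}=\sum_{j\ge0}\frac{B_j}{j!}t^j$. *)

(* Defs.v *)
From HB Require Import structures.
From mathcomp Require Import all_boot all_algebra all_fingroup.
From mathcomp Require Import generic_quotient boolp.

Set Implicit Arguments.
Unset Strict Implicit.
Unset Printing Implicit Defensive.

Import GRing.Theory.
Local Open Scope ring_scope.

(* (-1)^d; used for Koszul signs, where d is a product of degrees. *)
Definition sgn (K : fieldType) (d : int) : K := (-1) ^ d.

(* [pres R] is the K-module generated by T subject to the relators R, a relator
   being a formal sum read as "= 0".  Two formal sums are identified when they
   take the same value under every map from T to a K-module that kills all
   relators; [lift], [lift_gen] and [pres_ext] below are the universal property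
   that characterizes the quotient of the free module by the span of R. *)

Section Presentation.
Variables (K : fieldType) (T : choiceType) (R : seq (K * T) -> Prop).

Definition fsum (U : lmodType K) (f : T -> U) (s : seq (K * T)) : U :=
  \sum_(x <- s) x.1 *: f x.2.

Definition kills (U : lmodType K) (f : T -> U) : Prop :=
  forall r, R r -> fsum f r = 0.

Definition pres_equiv : rel (seq (K * T)) := fun s t =>
  `[< forall (U : lmodType K) (f : T -> U), kills f -> fsum f s = fsum f t >].

Lemma pres_equivP s t :
  reflect (forall (U : lmodType K) (f : T -> U), kills f -> fsum f s = fsum f t)
          (pres_equiv s t).
Proof. exact: asboolP. Qed.

Lemma pres_equiv_refl : reflexive pres_equiv.
Proof. by move=> s; apply/pres_equivP. Qed.

Lemma pres_equiv_sym : symmetric pres_equiv.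
Proof. by move=> s t; apply/pres_equivP/pres_equivP => h U f /h. Qed.

Lemma pres_equiv_trans : transitive pres_equiv.
Proof.
move=> t s u /pres_equivP h1 /pres_equivP h2; apply/pres_equivP => U f hf.
by rewrite h1 // h2.
Qed.

Canonical pres_equivRel :=
  EquivRel pres_equiv pres_equiv_refl pres_equiv_sym pres_equiv_trans.

Definition pres := {eq_quot pres_equiv}%qT.

HB.instance Definition _ := Choice.on pres.

Definition class (s : seq (K * T)) : pres := (\pi_(pres) s)%qT.

Lemma class_eq s t :
  (forall (U : lmodType K) (f : T -> U), kills f -> fsum f s = fsum f t) ->
  class s = class t.
Proof. by move=> h; apply/eqmodP/pres_equivP. Qed.

Lemma fsum_repr_class (U : lmodType K) (f : T -> U) s :
  kills f -> fsum f (repr (class s)) = fsum f s.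
Proof.
move=> hf; have /eqmodP/pres_equivP : (repr (class s) = s %[mod pres])%qT.
  by rewrite reprK.
exact.
Qed.

Lemma class_repr (x : pres) : class (repr x) = x.
Proof. exact: reprK. Qed.

Definition scale_seq (a : K) (s : seq (K * T)) := [seq (a * x.1, x.2) | x <- s].

Lemma fsum_cat (U : lmodType K) (f : T -> U) s t :
  fsum f (s ++ t) = fsum f s + fsum f t.
Proof. exact: big_cat. Qed.

Lemma fsum_scale (U : lmodType K) (f : T -> U) a s :
  fsum f (scale_seq a s) = a *: fsum f s.
Proof.
rewrite /fsum big_map scaler_sumr; apply: eq_bigr => x _ /=.
by rewrite scalerA.
Qed.

Lemma fsum_nil (U : lmodType K) (f : T -> U) : fsum f [::] = 0.
Proof. exact: big_nil. Qed.

Definition pres_add (x y : pres) := class (repr x ++ repr y).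
Definition pres_opp (x : pres) := class (scale_seq (-1) (repr x)).
Definition pres_scale (a : K) (x : pres) := class (scale_seq a (repr x)).

Let presE := (fsum_cat, fsum_scale, fsum_nil, fsum_repr_class).

Fact pres_addA : associative pres_add.
Proof.
by move=> x y z; apply: class_eq => U f hf; rewrite !presE // addrA.
Qed.

Fact pres_addC : commutative pres_add.
Proof. by move=> x y; apply: class_eq => U f hf; rewrite !presE // addrC. Qed.

Fact pres_add0 : left_id (class [::]) pres_add.
Proof.
move=> x; rewrite -[RHS]class_repr.
by apply: class_eq => U f hf; rewrite !presE // add0r.
Qed.

Fact pres_addN : left_inverse (class [::]) pres_opp pres_add.
Proof.
by move=> x; apply: class_eq => U f hf; rewrite !presE // scaleN1r addNr.
Qed.

HB.instance Definition _ :=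
  GRing.isZmodule.Build pres pres_addA pres_addC pres_add0 pres_addN.

Fact pres_scaleA a b x : pres_scale a (pres_scale b x) = pres_scale (a * b) x.
Proof. by apply: class_eq => U f hf; rewrite !presE // scalerA. Qed.

Fact pres_scale1 : left_id 1 pres_scale.
Proof.
move=> x; rewrite -[RHS]class_repr.
by apply: class_eq => U f hf; rewrite !presE // scale1r.
Qed.

Fact pres_scaleDr : right_distributive pres_scale +%R.
Proof.
by move=> a x y; apply: class_eq => U f hf; rewrite !presE // scalerDr.
Qed.

Fact pres_scaleDl x : {morph pres_scale^~ x : a b / a + b}.
Proof.
by move=> a b; apply: class_eq => U f hf; rewrite !presE // scalerDl.
Qed.

HB.instance Definition _ :=
  GRing.Zmodule_isLmodule.Build K pres
    pres_scaleA pres_scale1 pres_scaleDr pres_scaleDl.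

Definition gen (t : T) : pres := class [:: (1, t)].

Lemma class_fsum s : class s = fsum gen s.
Proof.
elim: s => [|[a t] s IH]; first by rewrite fsum_nil.
rewrite /fsum big_cons -/(fsum gen s) -IH /=.
apply: class_eq => U f hf; rewrite !presE // /fsum big_cons /= big_seq1.
by rewrite scale1r.
Qed.

Lemma kills_gen : kills gen.
Proof.
move=> r hr; rewrite -class_fsum; apply: class_eq => U f hf.
by rewrite fsum_nil hf.
Qed.

Lemma pres_ext (U : lmodType K) (f g : {linear pres -> U}) :
  (forall t, f (gen t) = g (gen t)) -> f =1 g.
Proof.
move=> h x; rewrite -[x]class_repr class_fsum /fsum !linear_sum.
by apply: eq_bigr => y _; rewrite !linearZ h.
Qed.

Section Lift.
Variables (U : lmodType K) (f : T -> U) (hf : kills f).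

Definition lift of kills f := fun x : pres => fsum f (repr x).

Fact lift_linear : linear (lift hf).
Proof. by move=> a x y; rewrite /lift !presE. Qed.

HB.instance Definition _ := GRing.isLinear.Build K pres U _ (lift hf) lift_linear.

Lemma lift_gen t : lift hf (gen t) = f t.
Proof. by rewrite /lift presE // /fsum big_seq1 scale1r. Qed.

End Lift.
End Presentation.

Section Tensor.
Variable K : fieldType.

Inductive tens_rel (V W : lmodType K) : seq (K * (V * W)) -> Prop :=
| TensRelL a v1 v2 w :
    tens_rel [:: (1, (a *: v1 + v2, w)); (- a, (v1, w)); (-1, (v2, w))]
| TensRelR a v w1 w2 :
    tens_rel [:: (1, (v, a *: w1 + w2)); (- a, (v, w1)); (-1, (v, w2))].

Definition tensor (V W : lmodType K) := pres (@tens_rel V W).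
HB.instance Definition _ (V W : lmodType K) := GRing.Lmodule.on (tensor V W).

Definition tens (V W : lmodType K) (v : V) (w : W) : tensor V W :=
  gen (@tens_rel V W) (v, w).

Lemma fsum3 (T : choiceType) (U : lmodType K) (f : T -> U) a (x y z : T) :
  (fsum f [:: (1, x); (- a, y); (-1, z)] = 0) <-> (f x = a *: f y + f z).
Proof.
rewrite /fsum !big_cons big_nil /= scale1r addr0 scaleNr scaleN1r -opprD.
by split=> [/subr0_eq|->]; rewrite ?subrr.
Qed.

Lemma tensDl (V W : lmodType K) (w : W) : linear (fun v : V => tens v w).
Proof. by move=> a v1 v2; apply/(fsum3 (gen _))/kills_gen; constructor. Qed.

Lemma tensDr (V W : lmodType K) (v : V) : linear (fun w : W => tens v w).
Proof. by move=> a w1 w2; apply/(fsum3 (gen _))/kills_gen; constructor. Qed.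

Lemma tens_kills (V W U : lmodType K) (f : V -> W -> U) :
  (forall w, linear (f^~ w)) -> (forall v, linear (f v)) ->
  kills (@tens_rel V W) (fun x => f x.1 x.2).
Proof.
move=> fl fr _ [a v1 v2 w|a v w1 w2]; apply/fsum3 => /=.
  exact: fl.
exact: fr.
Qed.

Lemma tensZl (V W : lmodType K) a (v : V) (w : W) :
  tens (a *: v) w = a *: tens v w.
Proof.
pose f : {linear V -> tensor V W} :=
  HB.pack (fun u : V => tens u w)
    (GRing.isLinear.Build K V (tensor V W) _ _ (@tensDl V W w)).
exact: (linearZZ f).
Qed.

Lemma tensZr (V W : lmodType K) a (v : V) (w : W) :
  tens v (a *: w) = a *: tens v w.
Proof.
pose f : {linear W -> tensor V W} :=
  HB.pack (fun u : W => tens v u)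
    (GRing.isLinear.Build K W (tensor V W) _ _ (@tensDr V W v)).
exact: (linearZZ f).
Qed.

Section TensMap.
Variables (V W V' W' : lmodType K) (f : {linear V -> V'}) (g : {linear W -> W'}).

Fact tmap_kills : kills (@tens_rel V W) (fun x => tens (f x.1) (g x.2)).
Proof.
apply: (@tens_kills V W _ (fun v w => tens (f v) (g w))) => [w|v] a x y /=.
  by rewrite linearP tensDl.
by rewrite linearP tensDr.
Qed.

(* f (x) g without Koszul sign; signs are put in f, see [ksign]. *)
Definition tmap : tensor V W -> tensor V' W' := lift tmap_kills.
HB.instance Definition _ := GRing.Linear.on tmap.

Lemma tmap_tens v w : tmap (tens v w) = tens (f v) (g w).
Proof. exact: lift_gen. Qed.

End TensMap.
End Tensor.

Record gradedSpace (K : fieldType) := GradedSpace {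
  gs_sort :> lmodType K;
  gdeg : int -> submodClosed gs_sort;
  gdeg_sum : forall v : gs_sort, exists (s : seq int) (f : int -> gs_sort),
    (forall d, f d \in gdeg d) /\ v = \sum_(d <- s) f d;
  gdeg_indep : forall (s : seq int) (f : int -> gs_sort),
    uniq s -> (forall d, f d \in gdeg d) -> \sum_(d <- s) f d = 0 ->
    forall d, d \in s -> f d = 0
}.

Record gradedLie (K : fieldType) := GradedLie {
  gl_space :> gradedSpace K;
  br : gl_space -> gl_space -> gl_space;
  br_linl : forall y, linear (br^~ y);
  br_linr : forall x, linear (br x);
  br_deg : forall i j x y,
    x \in gdeg gl_space i -> y \in gdeg gl_space j ->
    br x y \in gdeg gl_space (i + j);
  br_anti : forall i j x y,
    x \in gdeg gl_space i -> y \in gdeg gl_space j ->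
    br x y = - (sgn K (i * j) *: br y x);
  br_jacobi : forall i j x y z,
    x \in gdeg gl_space i -> y \in gdeg gl_space j ->
    br x (br y z) = br (br x y) z + sgn K (i * j) *: br y (br x z)
}.

Record gradedSubLie (K : fieldType) (M : gradedLie K) := GradedSubLie {
  gsl_pred :> submodClosed M;
  gsl_graded : forall x, x \in gsl_pred -> exists (s : seq int) (f : int -> M),
    (forall d, f d \in gdeg M d /\ f d \in gsl_pred) /\ x = \sum_(d <- s) f d;
  gsl_br : forall x y, x \in gsl_pred -> y \in gsl_pred ->
    br x y \in gsl_pred
}.

Section SubSpace.
Variables (K : fieldType) (M : gradedLie K) (A : gradedSubLie M).

Record sub_elt := SubElt { sub_val : M; sub_valP : sub_val \in gsl_pred A }.

HB.instance Definition _ := [isSub for sub_val].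
HB.instance Definition _ := [Choice of sub_elt by <:].
HB.instance Definition _ := [SubChoice_isSubLmodule of sub_elt by <:].

Fact sub_val_linear : linear sub_val.
Proof. by move=> c a b; rewrite -[sub_val]/(\val : sub_elt -> M) linearP. Qed.
HB.instance Definition _ :=
  GRing.isLinear.Build K sub_elt M _ sub_val sub_val_linear.

Definition sub_deg_pred (d : int) : {pred sub_elt} :=
  [pred a | sub_val a \in gdeg M d].

Fact sub_deg_closed d : submod_closed (sub_deg_pred d).
Proof.
split=> [|c a b]; rewrite !inE ?linear0 ?rpred0 // linearP => ha hb.
by rewrite rpredD // rpredZ.
Qed.

HB.instance Definition _ d :=
  GRing.isSubmodClosed.Build K sub_elt (sub_deg_pred d) (sub_deg_closed d).

Definition sub_deg (d : int) : submodClosed sub_elt := sub_deg_pred d.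

Fact sub_deg_sum (v : sub_elt) : exists (s : seq int) (f : int -> sub_elt),
  (forall d, f d \in sub_deg d) /\ v = \sum_(d <- s) f d.
Proof.
have [s [f [hf hv]]] := gsl_graded (sub_valP v).
exists s, (fun d => SubElt (proj2 (hf d))); split=> [d|].
  by rewrite inE; case: (hf d).
by apply: val_inj; rewrite /= hv linear_sum.
Qed.

Fact sub_deg_indep (s : seq int) (f : int -> sub_elt) :
  uniq s -> (forall d, f d \in sub_deg d) -> \sum_(d <- s) f d = 0 ->
  forall d, d \in s -> f d = 0.
Proof.
move=> us hf h d ds; apply: val_inj; rewrite -[RHS]/(sub_val 0) linear0.
apply: (@gdeg_indep _ M s (fun d => sub_val (f d)) us hf _ d ds).
by rewrite -linear_sum h linear0.
Qed.

Definition sub_space : gradedSpace K := GradedSpace sub_deg_sum sub_deg_indep.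

End SubSpace.

Coercion sub_space : gradedSubLie >-> gradedSpace.

Section SymmetricCoalgebra.
Variables (K : fieldType) (V : gradedSpace K).

Definition letter := {x : int * V | x.2 \in gdeg V x.1}.
HB.instance Definition _ := Choice.on letter.

Definition ldeg (x : letter) : int := (val x).1.
Definition lval (x : letter) : V := (val x).2.
Definition wdeg (w : seq letter) : int := \sum_(x <- w) ldeg x.

Inductive sym_rel : seq (K * seq letter) -> Prop :=
| SymRelLin a u v x y z :
    ldeg y = ldeg x -> ldeg z = ldeg x -> lval x = a *: lval y + lval z ->
    sym_rel [:: (1, u ++ x :: v); (- a, u ++ y :: v); (-1, u ++ z :: v)]
| SymRelSwap u v x y :
    sym_rel [:: (1, u ++ x :: y :: v);
                (- sgn K (ldeg x * ldeg y), u ++ y :: x :: v)].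

(* Generated by the words v_1 (.) ... (.) v_n in homogeneous vectors, n >= 0. *)
Definition SymCoalg := pres sym_rel.
HB.instance Definition _ := GRing.Lmodule.on SymCoalg.

Definition word (w : seq letter) : SymCoalg := gen sym_rel w.

Lemma fsum2 (T : choiceType) (U : lmodType K) (f : T -> U) a (x y : T) :
  (fsum f [:: (1, x); (- a, y)] = 0) <-> (f x = a *: f y).
Proof.
rewrite /fsum !big_cons big_nil /= scale1r addr0 scaleNr.
by split=> [/subr0_eq|->]; rewrite ?subrr.
Qed.

Lemma word_lin a u v x y z :
  ldeg y = ldeg x -> ldeg z = ldeg x -> lval x = a *: lval y + lval z ->
  word (u ++ x :: v) = a *: word (u ++ y :: v) + word (u ++ z :: v).
Proof. by move=> h1 h2 h3; apply/fsum3/kills_gen; constructor. Qed.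

Lemma word_swap u v x y :
  word (u ++ x :: y :: v) =
  sgn K (ldeg x * ldeg y) *: word (u ++ y :: x :: v).
Proof. by apply/fsum2/kills_gen; constructor. Qed.

Lemma sym_kills (U : lmodType K) (f : seq letter -> U) :
  (forall a u v x y z,
     ldeg y = ldeg x -> ldeg z = ldeg x -> lval x = a *: lval y + lval z ->
     f (u ++ x :: v) = a *: f (u ++ y :: v) + f (u ++ z :: v)) ->
  (forall u v x y, f (u ++ x :: y :: v) =
     sgn K (ldeg x * ldeg y) *: f (u ++ y :: x :: v)) ->
  kills sym_rel f.
Proof.
move=> hl hs _ [a u v x y z h1 h2 h3|u v x y]; last exact/fsum2.
by apply/fsum3; apply: hl.
Qed.

Lemma wdeg_cat u v : wdeg (u ++ v) = wdeg u + wdeg v.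
Proof. exact: big_cat. Qed.

Lemma wdeg_cons x v : wdeg (x :: v) = ldeg x + wdeg v.
Proof. exact: big_cons. Qed.

Section LeftMul.
Variable x : letter.
Fact lmul_kills : kills sym_rel (fun w => word (x :: w)).
Proof.
apply: sym_kills => [a u v y1 y2 y3|u v y1 y2]; rewrite -!cat_cons.
  exact: word_lin.
exact: word_swap.
Qed.
Definition lmul : SymCoalg -> SymCoalg := lift lmul_kills.
HB.instance Definition _ := GRing.Linear.on lmul.
End LeftMul.

Lemma lmul_word x w : lmul x (word w) = word (x :: w).
Proof. exact: lift_gen. Qed.

(* u |-> (-1)^(d |u|) u, so that (1 (x) Q)(u (x) v) = (-1)^(|Q| |u|) u (x) Q v
   is tmap (ksign |Q|) Q. *)
Section KoszulSign.
Variable d : int.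
Fact ksign_kills : kills sym_rel (fun w => sgn K (d * wdeg w) *: word w).
Proof.
apply: sym_kills => [a u v x y z h1 h2 h3|u v x y].
  rewrite (word_lin _ _ h1 h2 h3) !wdeg_cat !wdeg_cons h1 h2.
  by rewrite scalerDr !scalerA mulrC.
rewrite word_swap !wdeg_cat !wdeg_cons !scalerA mulrC.
by congr (_ * sgn K (d * (_ + _)) *: _); rewrite addrCA.
Qed.
Definition ksign : SymCoalg -> SymCoalg := lift ksign_kills.
HB.instance Definition _ := GRing.Linear.on ksign.
End KoszulSign.

Lemma ksign_word d w : ksign d (word w) = sgn K (d * wdeg w) *: word w.
Proof. exact: lift_gen. Qed.

Definition wcorestr (w : seq letter) : V :=
  if w is [:: x] then lval x else 0.

Fact corestr_kills : kills sym_rel wcorestr.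
Proof.
apply: sym_kills => [a [|x0 [|x1 u]] [|y0 v] x y z _ _ h|[|x0 [|x1 u]] v x y] //=;
  by rewrite ?scaler0 ?addr0.
Qed.
Definition corestr : SymCoalg -> V := lift corestr_kills.
HB.instance Definition _ := GRing.Linear.on corestr.

Lemma corestr_word w : corestr (word w) = wcorestr w.
Proof. exact: lift_gen. Qed.

(* (x (x) 1 + 1 (x) x)(u (x) v) = xu (x) v + (-1)^(|x| |u|) u (x) xv *)
Definition primop (x : letter) (t : tensor SymCoalg SymCoalg) : tensor SymCoalg SymCoalg :=
  tmap (lmul x) idfun t + tmap (ksign (ldeg x)) (lmul x) t.

Fact primop_linear x : linear (primop x).
Proof. by move=> a s t; rewrite /primop !linearP /= scalerDr addrACA. Qed.
HB.instance Definition _ x :=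
  GRing.isLinear.Build K (tensor SymCoalg SymCoalg) (tensor SymCoalg SymCoalg) _ (primop x)
    (primop_linear x).

Lemma tensor_ext (V1 W1 U : lmodType K) (f g : {linear tensor V1 W1 -> U}) :
  (forall v w, f (tens v w) = g (tens v w)) -> f =1 g.
Proof. by move=> h; apply: pres_ext => -[v w]; apply: h. Qed.

Lemma lmul_lin a x y z (t : SymCoalg) :
  ldeg y = ldeg x -> ldeg z = ldeg x -> lval x = a *: lval y + lval z ->
  lmul x t = a *: lmul y t + lmul z t.
Proof.
move=> h1 h2 h3.
pose g := (a \*: lmul y \+ lmul z) : {linear SymCoalg -> SymCoalg}.
apply: (@pres_ext _ _ _ _ (lmul x) g) => w.
by rewrite /g /= !lmul_word; apply: (@word_lin a [::]).
Qed.

Lemma ksign_lmul d x (t : SymCoalg) :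
  ksign d (lmul x t) = sgn K (d * ldeg x) *: lmul x (ksign d t).
Proof.
pose g := (sgn K (d * ldeg x) \*: (lmul x \o ksign d)) : {linear SymCoalg -> SymCoalg}.
apply: (@pres_ext _ _ _ _ (ksign d \o lmul x) g) => w.
rewrite /g /= !(lmul_word, ksign_word) linearZ /= lmul_word scalerA.
by rewrite wdeg_cons mulrDr /sgn expfzDr ?oppr_eq0 ?oner_eq0.
Qed.

Lemma lmul_swap x y (t : SymCoalg) :
  lmul x (lmul y t) = sgn K (ldeg x * ldeg y) *: lmul y (lmul x t).
Proof.
pose g := (sgn K (ldeg x * ldeg y) \*: (lmul y \o lmul x)) : {linear SymCoalg -> SymCoalg}.
apply: (@pres_ext _ _ _ _ (lmul x \o lmul y) g) => w.
by rewrite /g /= !lmul_word; apply: (@word_swap [::]).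
Qed.

Lemma ksignC d e (t : SymCoalg) : ksign d (ksign e t) = ksign e (ksign d t).
Proof.
apply: (@pres_ext _ _ _ _ (ksign d \o ksign e) (ksign e \o ksign d)) => w /=.
by rewrite !(ksign_word, linearZ) /= !ksign_word !scalerA mulrC.
Qed.

Lemma sgn_sqr d : sgn K d * sgn K d = 1.
Proof. by rewrite /sgn -expfzMl mulrNN mulr1 exp1rz. Qed.

Lemma primop_tens x u v :
  primop x (tens u v) =
  tens (lmul x u) v + tens (ksign (ldeg x) u) (lmul x v).
Proof. by rewrite /primop !tmap_tens. Qed.

Lemma primop_lin a x y z (t : tensor SymCoalg SymCoalg) :
  ldeg y = ldeg x -> ldeg z = ldeg x -> lval x = a *: lval y + lval z ->
  primop x t = a *: primop y t + primop z t.
Proof.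
move=> h1 h2 h3.
pose g := (a \*: primop y \+ primop z) : {linear tensor SymCoalg SymCoalg -> tensor SymCoalg SymCoalg}.
apply: (@tensor_ext _ _ _ (primop x) g) => u v.
rewrite /g /= !primop_tens !(lmul_lin _ h1 h2 h3) h1 h2 tensDl tensDr.
by rewrite scalerDr addrACA.
Qed.

Lemma primop_swap x y (t : tensor SymCoalg SymCoalg) :
  primop x (primop y t) = sgn K (ldeg x * ldeg y) *: primop y (primop x t).
Proof.
pose g := (sgn K (ldeg x * ldeg y) \*: (primop y \o primop x))
  : {linear tensor SymCoalg SymCoalg -> tensor SymCoalg SymCoalg}.
apply: (@tensor_ext _ _ _ (primop x \o primop y) g) => u v.
change (primop x (primop y (tens u v)) =
  sgn K (ldeg x * ldeg y) *: primop y (primop x (tens u v))).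
rewrite !primop_tens (linearD (primop x)) (linearD (primop y)) /= !primop_tens.
rewrite (lmul_swap x y u) (lmul_swap x y v) (ksignC (ldeg x) (ldeg y)) !ksign_lmul.
rewrite !tensZl tensZr !scalerDr !scalerA (mulrC (ldeg y)) sgn_sqr !scale1r.
by rewrite -!addrA; congr (_ + _); rewrite addrCA.
Qed.

Fact coprod_kills :
  kills sym_rel (foldr primop (tens (word [::]) (word [::]))).
Proof.
apply: sym_kills => [a u v x y z h1 h2 h3|u v x y]; elim: u => [|x0 u IH] /=.
- exact: primop_lin.
- by rewrite IH linearP.
- exact: primop_swap.
- by rewrite IH linearZ.
Qed.

(* The unshuffle coproduct, determined by Delta(1) = 1 (x) 1 and
   Delta(x (.) w) = (x (x) 1 + 1 (x) x) Delta(w). *)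
Definition coprod : SymCoalg -> tensor SymCoalg SymCoalg := lift coprod_kills.
HB.instance Definition _ := GRing.Linear.on coprod.

Lemma coprod_word w :
  coprod (word w) = foldr primop (tens (word [::]) (word [::])) w.
Proof. exact: lift_gen. Qed.

Definition sym_deg (e : int) (x : SymCoalg) : Prop :=
  exists s : seq (K * seq letter),
    (forall c, c \in s -> wdeg c.2 = e) /\ x = \sum_(c <- s) c.1 *: word c.2.

Definition coderivation (d : int) (Q : {linear SymCoalg -> SymCoalg}) : Prop :=
  (forall e x, sym_deg e x -> sym_deg (e + d) (Q x)) /\
  (forall x, coprod (Q x) =
     tmap Q idfun (coprod x) + tmap (ksign d) Q (coprod x)).

(* The i-th Taylor coefficient is the restriction to words of length i of the
   corestriction of Q. *)
Definition taylor (Q : {linear SymCoalg -> SymCoalg}) (w : seq letter) : V :=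
  corestr (Q (word w)).

End SymmetricCoalgebra.

Arguments SymCoalg {K} V.

(* [f, g] for f of degree d and g of degree e. *)
Definition gcomm (K : fieldType) (U : lmodType K) (d e : int) (f g : U -> U) :=
  fun x : U => f (g x) - sgn K (d * e) *: g (f x).

Fact gcomm_linear (K : fieldType) (U : lmodType K) d e (f g : {linear U -> U}) :
  linear (gcomm d e f g).
Proof.
move=> a x y; rewrite /gcomm (linearP g) !(linearP f) (linearP g).
by rewrite scalerBr !scalerDr !scalerA (mulrC a) opprD addrACA.
Qed.

HB.instance Definition _ (K : fieldType) (U : lmodType K) d e
    (f g : {linear U -> U}) :=
  GRing.isLinear.Build K U U _ (gcomm d e f g) (gcomm_linear d e f g).

Definition derivation (K : fieldType) (M : gradedLie K) (d : int)
    (D : {linear M -> M}) : Prop :=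
  (forall e x, x \in gdeg M e -> D x \in gdeg M (e + d)) /\
  (forall e x y, x \in gdeg M e ->
     D (br x y) = br (D x) y + sgn K (d * e) *: br x (D y)).

(* A homogeneous element of degree d of Der(M/L). *)
Definition der_pres (K : fieldType) (M : gradedLie K) (L : gradedSubLie M)
    (d : int) (D : {linear M -> M}) : Prop :=
  derivation d D /\ forall x, x \in gsl_pred L -> D x \in gsl_pred L.

Section Bernoulli.
Variable K : fieldType.

(* [:: B_0 / 0!; ...; B_(n-1) / (n-1)!] *)
Fixpoint bernoulli_egf (n : nat) : seq K :=
  if n is m.+1 then
    let s := bernoulli_egf m in
    rcons s ((m == 0%N)%:R - \sum_(j < m) s`_j / ((m - j).+1)`!%:R)
  else [::].

Definition bernoulli (n : nat) : K := n`!%:R * (bernoulli_egf n.+1)`_n.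

Lemma size_bernoulli_egf n : size (bernoulli_egf n) = n.
Proof. by elim: n => //= n IH; rewrite size_rcons IH. Qed.

Lemma nth_bernoulli_egf n j : (j < n)%N ->
  (bernoulli_egf n)`_j = (bernoulli_egf j.+1)`_j.
Proof.
elim: n => // n IH; rewrite ltnS leq_eqVlt => /predU1P[-> //|jn].
by rewrite [LHS]/= nth_rcons size_bernoulli_egf jn IH.
Qed.

(* The coefficient of t^n in ((e^t - 1) / t) * (\sum_j B_j / j! t^j) = 1. *)
Lemma bernoulliP (charK : [pchar K] =i pred0) n :
  \sum_(j < n.+1) bernoulli j / j`!%:R / ((n - j).+1)`!%:R = (n == 0%N)%:R.
Proof.
have fact_neq0 m : m`!%:R != 0 :> K by rewrite (pcharf0P K).1 // -lt0n fact_gt0.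
have bE m : bernoulli m / m`!%:R = (bernoulli_egf m.+1)`_m.
  by rewrite /bernoulli mulrC mulKf.
have last_eq : (bernoulli_egf n.+1)`_n =
    (n == 0%N)%:R - \sum_(j < n) (bernoulli_egf n)`_j / ((n - j).+1)`!%:R.
  by rewrite [LHS]nth_rcons size_bernoulli_egf ltnn eqxx.
rewrite big_ord_recr bE subnn (_ : 1`! = 1)%N // divr1 last_eq /= addrC -addrA.
rewrite -[RHS]addr0; congr (_ + _).
apply/eqP; rewrite addrC subr_eq0; apply/eqP/eq_bigr => j _.
by rewrite bE (nth_bernoulli_egf (ltn_ord j)).
Qed.

End Bernoulli.

Section PhiCoefficients.
Variables (K : fieldType) (M : gradedLie K) (A : gradedSubLie M).
Variable P : {linear M -> A}.

Definition iter_br (x : M) (s : seq M) : M := foldl (@br K M) x s.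

(* a_1 (.) ... (.) a_n = koszul d s a_(s 1) (.) ... (.) a_(s n), d_i = |a_i| *)
Definition koszul (n : nat) (d : 'I_n -> int) (s : 'S_n) : K :=
  \prod_(i < n) \prod_(j < n | (i < j)%N && (s j < s i)%N)
    sgn K (d (s i) * d (s j)).

Definition sym_sum (w : seq (letter A)) (F : seq M -> M) : M :=
  \sum_(s : 'S_(size w))
    koszul (fun i => ldeg (tnth (in_tuple w) i)) s *:
    F [seq sub_val (lval (tnth (in_tuple w) (s i))) | i <- enum 'I_(size w)].

Definition phi_coef (i k : nat) : K :=
  bernoulli K (i - k) / (k`! * (i - k)`!)%:R.

Definition phi_elt (m : M) (w : seq (letter A)) : M :=
  if w is [::] then sub_val (P m) else
  let i := size w in
  sym_sum w (fun s => \sum_(0 <= k < i.+1)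
    phi_coef i k *: iter_br (sub_val (P (iter_br m (take k s)))) (drop k s)).

(* On nonempty words s the term for k >= 1 involves
   [..[D s_1, s_2] .., s_k]; the empty word has coefficient 0. *)
Definition phi_der (D : M -> M) (w : seq (letter A)) : M :=
  let i := size w in
  sym_sum w (fun s => \sum_(1 <= k < i.+1)
    phi_coef i k *:
    iter_br (sub_val (P (iter_br (D (head 0 s)) (take k.-1 (behead s)))))
      (drop k s)).

Definition is_Phi_elt (d : int) (m : M) (Q : {linear SymCoalg A -> SymCoalg A}) : Prop :=
  coderivation d Q /\ forall w, sub_val (taylor Q w) = phi_elt m w.

(* Coder(\bar S A) sits in Coder(SA) as the coderivations with q_0 = 0. *)
Definition is_Phi_der (d : int) (D : M -> M) (Q : {linear SymCoalg A -> SymCoalg A}) : Prop :=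
  coderivation d Q /\ forall w, sub_val (taylor Q w) = phi_der D w.

End PhiCoefficients.

(* Main.v *)
Require Import Defs.
From HB Require Import structures.
From mathcomp Require Import all_boot all_algebra all_fingroup.
From mathcomp Require Import generic_quotient boolp.

Set Implicit Arguments.
Unset Strict Implicit.
Unset Printing Implicit Defensive.

Import GRing.Theory.
Local Open Scope ring_scope.

(** Geometrically, Phi(m) is the vector field by which m acts on the formal
    homogeneous space exp(M)/exp(L), read in the chart a |-> exp(a) exp(L), and
    Phi(D) does the same for automorphisms that preserve L; the identities say
    that infinitesimal actions are Lie algebra morphisms.  The proof below is the
    algebraic form of this remark.

    Let SA be the symmetric coalgebra of A.  The space g of linear maps
    SA -> M is a graded Lie algebra for the convolution bracket
    [F, G] = br o (F (x) G) o Delta, and all Koszul signs are absorbed in this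
    bracket.  The generic point of A is the degree 0 element univ of g, namely
    the corestriction SA -> A followed by the inclusion.  Write R for
    F |-> [F, univ], which is - ad univ, and
      theta(R) = sum_k R^k / (k+1)! = (e^R - 1) / R,
      bern(R)  = sum_k B_k R^k / k! = R / (e^R - 1),
    two inverse operators, locally finite because R raises word length.

    A symmetrized iterated bracket is a power of R (represents_adr), so the Taylor
    coefficients of Phi are
      univ o Phi = bern(R) (proj x),   x = m + theta(R) (D univ),
    where D = ad m for an element m, so that x = e^R m, and where m = 0 for a
    derivation (generates_elt, generates_der).  Both families are thus instances
    of one construction on pairs (m, D) for which D - ad m preserves L, and the
    three identities are the same statement about pairs.

    A coderivation Q acts on g by F |-> F o Q, which is a derivation of the
    convolution bracket (conv_precomp), and so is F |-> D o F (comp_lie).  For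
    two derivations of g the operator theta satisfies the Maurer-Cartan equation
    of a logarithmic derivative (maurer_cartan).  Put p_i = proj x_i; then
    p_i = theta (univ o Q_i), and the Maurer-Cartan equation gives, with E_i the
    map D_i - ad m_i,
      x_1 o Q_2 = E_1 p_2 + [x_1, p_2]                        (moment_precomp)
      x_[1,2]   = E_1 x_2 - (+/-) E_2 x_1 + [x_1, x_2]        (bracket_moment)
      theta (univ o [Q_1, Q_2])
                = p_1 o Q_2 - (+/-) p_2 o Q_1 - [p_1, p_2].
    As L and A are subalgebras and E_i preserves L, the projection of the second
    line equals the third one (proj_precomp_bracket).  Hence [Q_1, Q_2] and the
    coderivation attached to the bracket of the pairs have equal corestrictions,
    and they coincide because in characteristic zero a coderivation is determined
    by its corestriction (coderivation_ext). *)

(** * The module of linear maps *)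

Section LinearMaps.
Variables (K : fieldType) (U V : lmodType K).

Lemma linear_map_eq (f g : {linear U -> V}) : f =1 g -> f = g.
Proof.
move: f g => [f cf] [g cg] /= /funext fg; subst g; congr (GRing.Linear.Pack _).
move: cf cg => [[m1] [m2]] [[m3] [m4]].
by rewrite (Prop_irrelevance m1 m3) (Prop_irrelevance m2 m4).
Qed.

HB.instance Definition _ := gen_eqMixin {linear U -> V}.
HB.instance Definition _ := gen_choiceMixin {linear U -> V}.

Definition lzero : {linear U -> V} := \0.
Definition ladd (f g : {linear U -> V}) : {linear U -> V} := f \+ g.
Definition lopp (f : {linear U -> V}) : {linear U -> V} := \- f.
Definition lscale (c : K) (f : {linear U -> V}) : {linear U -> V} := c \*: f.

Fact laddA : associative ladd.
Proof. by move=> f g h; apply: linear_map_eq => x; apply: addrA. Qed.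
Fact laddC : commutative ladd.
Proof. by move=> f g; apply: linear_map_eq => x; apply: addrC. Qed.
Fact ladd0 : left_id lzero ladd.
Proof. by move=> f; apply: linear_map_eq => x; apply: add0r. Qed.
Fact laddN : left_inverse lzero lopp ladd.
Proof. by move=> f; apply: linear_map_eq => x; apply: addNr. Qed.
HB.instance Definition _ :=
  GRing.isZmodule.Build {linear U -> V} laddA laddC ladd0 laddN.

Fact lscaleA a b f : lscale a (lscale b f) = lscale (a * b) f.
Proof. by apply: linear_map_eq => x; apply: scalerA. Qed.
Fact lscale1 : left_id 1 lscale.
Proof. by move=> f; apply: linear_map_eq => x; apply: scale1r. Qed.
Fact lscaleDr : right_distributive lscale +%R.
Proof. by move=> a f g; apply: linear_map_eq => x; apply: scalerDr. Qed.
Fact lscaleDl f : {morph lscale^~ f : a b / a + b}.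
Proof. by move=> a b; apply: linear_map_eq => x; apply: scalerDl. Qed.
HB.instance Definition _ :=
  GRing.Zmodule_isLmodule.Build K {linear U -> V}
    lscaleA lscale1 lscaleDr lscaleDl.

Lemma lzeroE x : (0 : {linear U -> V}) x = 0.
Proof. by []. Qed.
Lemma laddE (f g : {linear U -> V}) x : (f + g) x = f x + g x.
Proof. by []. Qed.
Lemma loppE (f : {linear U -> V}) x : (- f) x = - f x.
Proof. by []. Qed.
Lemma lscaleE c (f : {linear U -> V}) x : (c *: f) x = c *: f x.
Proof. by []. Qed.
Lemma lsumE (I : Type) (r : seq I) (P : pred I) (F : I -> {linear U -> V}) x :
  (\sum_(i <- r | P i) F i) x = \sum_(i <- r | P i) F i x.
Proof. exact: (big_morph (fun f : {linear U -> V} => f x)). Qed.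

End LinearMaps.

Definition linE := (lzeroE, laddE, loppE, lscaleE, lsumE).

Section Composition.
Variables (K : fieldType) (U V W : lmodType K).

Definition lcomp (g : {linear V -> W}) (f : {linear U -> V}) : {linear U -> W} :=
  g \o f.

Fact lcomp_linear g : linear (lcomp g).
Proof. by move=> c f h; apply: linear_map_eq => x; apply: (linearP g). Qed.
HB.instance Definition _ g :=
  GRing.isLinear.Build K {linear U -> V} {linear U -> W} _ (lcomp g)
    (lcomp_linear g).

Definition lprecomp (f : {linear U -> V}) (g : {linear V -> W}) := lcomp g f.
Fact lprecomp_linear f : linear (lprecomp f).
Proof. by move=> c g h; apply: linear_map_eq. Qed.
HB.instance Definition _ f :=
  GRing.isLinear.Build K {linear V -> W} {linear U -> W} _ (lprecomp f)
    (lprecomp_linear f).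

End Composition.

Notation "g \oo f" := (lcomp g f) (at level 39, left associativity).

(** * Bilinear maps *)

Section Bilinear.
Variables (K : fieldType).

Record bilinear_map (U V W : lmodType K) := BilinearMap {
  bmap :> U -> V -> W;
  bmap_linl : forall v, linear (bmap^~ v);
  bmap_linr : forall u, linear (bmap u)
}.

Variables (U V W : lmodType K) (b : bilinear_map U V W).

Definition on_tensor : tensor U V -> W :=
  Defs.lift (tens_kills (bmap_linl b) (bmap_linr b)).
HB.instance Definition _ := GRing.Linear.on on_tensor.

Lemma on_tensor_tens u v : on_tensor (tens u v) = b u v.
Proof. exact: lift_gen. Qed.

Lemma bmapZl c u v : b (c *: u) v = c *: b u v.
Proof.
pose f : {linear U -> W} :=
  HB.pack (fun u : U => b u v)
    (GRing.isLinear.Build K U W _ _ (bmap_linl b v)).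
exact: (linearZZ f).
Qed.

Lemma bmapZr c u v : b u (c *: v) = c *: b u v.
Proof.
pose f : {linear V -> W} :=
  HB.pack (fun v : V => b u v)
    (GRing.isLinear.Build K V W _ _ (bmap_linr b u)).
exact: (linearZZ f).
Qed.

Lemma bmap0l v : b 0 v = 0.
Proof. by rewrite -(scale0r 0) bmapZl scale0r. Qed.

Lemma bmap0r u : b u 0 = 0.
Proof. by rewrite -(scale0r 0) bmapZr scale0r. Qed.

End Bilinear.

(** * Convolution products on the symmetric coalgebra *)

Section Signs.
Variable K : fieldType.

Lemma sgnD (i j : int) : sgn K (i + j) = sgn K i * sgn K j.
Proof. by rewrite /sgn expfzDr // oppr_eq0 oner_eq0. Qed.

Lemma sgn0 : sgn K 0 = 1. Proof. by []. Qed.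

Lemma sgnK (i : int) (x : K) : sgn K i * (sgn K i * x) = x.
Proof. by rewrite mulrA sgn_sqr mul1r. Qed.

End Signs.

Section Words.
Variables (K : fieldType) (V : gradedSpace K).
Local Notation SV := (SymCoalg V).
Local Notation one := (word [::] : SV).

Lemma word_ext (U : lmodType K) (f g : {linear SV -> U}) :
  (forall w, f (word w) = g (word w)) -> f = g.
Proof. by move=> h; apply: linear_map_eq; apply: pres_ext. Qed.

Lemma tensor_hom_ext (U W X : lmodType K) (f g : {linear tensor U W -> X}) :
  (forall u v, f (tens u v) = g (tens u v)) -> f = g.
Proof. by move=> h; apply: linear_map_eq; apply: tensor_ext. Qed.

Lemma coprod_lmul x (t : SV) : coprod (lmul x t) = primop x (coprod t).
Proof.
apply: (@pres_ext _ _ _ _ (@coprod _ V \o @lmul _ V x)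
          (@primop _ V x \o @coprod _ V)) => w /=.
by rewrite lmul_word !coprod_word.
Qed.

Lemma ksignD d e (z : SV) : ksign (d + e) z = ksign d (ksign e z).
Proof.
apply: (@pres_ext _ _ _ _ (@ksign _ V (d + e))
  (@ksign _ V d \o @ksign _ V e)) => w /=.
by rewrite !(ksign_word, linearZ) /= !ksign_word scalerA mulrDl sgnD mulrC.
Qed.

Definition wcounit (w : seq (letter V)) : K^o := (w == [::])%:R.

Fact counit_kills : kills (@sym_rel K V) wcounit.
Proof.
by apply: sym_kills => [a [|? u] v x y z _ _ _|[|? u] v x y];
  rewrite /wcounit /= ?scaler0 ?addr0.
Qed.
Definition counit : SV -> K^o := Defs.lift counit_kills.
HB.instance Definition _ := GRing.Linear.on counit.

Lemma counit_word w : counit (word w) = (w == [::])%:R.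
Proof. exact: lift_gen. Qed.

(** Naming the bundled map lets composites F \oo mul_letter x be elements of the
    module of linear maps, which is where the inductions on words take place. *)
Definition mul_letter (x : letter V) : {linear SV -> SV} := lmul x.

Section Conv.
Variables (U1 U2 W : lmodType K) (b : bilinear_map U1 U2 W).
Implicit Types (F : {linear SV -> U1}) (G : {linear SV -> U2}).

(** The sign ksign e is the one of (F (x) G)(u (x) v) = (-1)^(e |u|) F u (x) G v
    for G of degree e.  Carrying e as an argument, rather than asking G to be
    homogeneous, makes conv linear in both functions.  The lock keeps
    simplification from exposing the tensor product. *)
Definition conv (e : int) F G : {linear SV -> W} :=
  locked (on_tensor b \oo tmap (F \oo @ksign _ V e) G \oo @coprod _ V).

Lemma convE e F G z :
  conv e F G z = on_tensor b (tmap (F \oo @ksign _ V e) G (coprod z)).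
Proof. by rewrite /conv -lock. Qed.

Lemma conv_one e F G : conv e F G one = b (F one) (G one).
Proof.
rewrite convE coprod_word /= tmap_tens on_tensor_tens /=.
by rewrite ksign_word /wdeg big_nil mulr0 sgn0 scale1r.
Qed.

(** Precomposition with Q (x) 1 + 1 (x) Q, where Q has degree d: this is shared by
    multiplication by a letter and by coderivations, whose compatibilities with the
    coproduct have this same form. *)
Lemma conv_coder e d F G (Q : {linear SV -> SV}) (T : tensor SV SV) :
  (forall z, ksign e (Q z) = sgn K (e * d) *: Q (ksign e z)) ->
  on_tensor b (tmap (F \oo @ksign _ V e) G
    (tmap Q idfun T + tmap (@ksign _ V d) Q T)) =
  sgn K (e * d) *: on_tensor b (tmap (F \oo Q \oo @ksign _ V e) G T) +
  on_tensor b (tmap (F \oo @ksign _ V (e + d)) (G \oo Q) T).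
Proof.
move=> hQ.
rewrite linearD /= linearD /=; congr (_ + _).
  pose f1 : {linear tensor SV SV -> W} :=
    on_tensor b \oo tmap (F \oo @ksign _ V e) G \oo tmap Q idfun.
  pose f2 : {linear tensor SV SV -> W} :=
    sgn K (e * d) *: (on_tensor b \oo tmap (F \oo Q \oo @ksign _ V e) G).
  suff /(congr1 (fun f : {linear _ -> _} => f T)) : f1 = f2 by [].
  apply: tensor_hom_ext => u v /=.
  rewrite !tmap_tens !on_tensor_tens /= hQ linearZ /=.
  by rewrite bmapZl.
pose f1 : {linear tensor SV SV -> W} :=
  on_tensor b \oo tmap (F \oo @ksign _ V e) G \oo tmap (@ksign _ V d) Q.
pose f2 : {linear tensor SV SV -> W} :=
  on_tensor b \oo tmap (F \oo @ksign _ V (e + d)) (G \oo Q).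
suff /(congr1 (fun f : {linear _ -> _} => f T)) : f1 = f2 by [].
by apply: tensor_hom_ext => u v /=; rewrite !tmap_tens !on_tensor_tens /= ksignD.
Qed.

(** Multiplying by a letter is a right derivation of the convolution product.
    Together with conv_one this computes a product on words by recursion, with no
    sum over unshuffles: identities between convolution products are proved by
    induction on the word, for all functions and degrees at once. *)
Lemma conv_mul_letter e F G x :
  conv e F G \oo mul_letter x =
  sgn K (e * ldeg x) *: conv e (F \oo mul_letter x) G +
  conv (e + ldeg x) F (G \oo mul_letter x).
Proof.
apply: linear_map_eq => z; rewrite linE /= !convE coprod_lmul /primop.
by rewrite conv_coder //= => t; rewrite ksign_lmul.
Qed.

Lemma conv_cons e F G x w :
  conv e F G (word (x :: w)) =
  sgn K (e * ldeg x) *: conv e (F \oo mul_letter x) G (word w) +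
  conv (e + ldeg x) F (G \oo mul_letter x) (word w).
Proof.
have := conv_mul_letter e F G x.
move/(congr1 (fun f : {linear _ -> _} => f (word w))).
by rewrite linE /= lmul_word.
Qed.

Fact conv_linr e F : linear (conv e F).
Proof.
move=> c G H; apply: word_ext => w; elim: w e F G H => [|x w IH] e F G H.
  by rewrite linE /= !conv_one bmap_linr.
rewrite !linE !conv_cons.
have -> : (c *: G + H) \oo mul_letter x =
   c *: (G \oo mul_letter x) + (H \oo mul_letter x) by apply: linear_map_eq.
by rewrite 2!IH !linE !scalerDr !scalerA (mulrC c) addrACA.
Qed.
HB.instance Definition _ e F :=
  GRing.isLinear.Build K {linear SV -> U2} {linear SV -> W} _ (conv e F)
    (conv_linr e F).

Definition convr e G F := conv e F G.

Fact conv_linl e G : linear (convr e G).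
Proof.
move=> c F H; rewrite /convr.
apply: word_ext => w; elim: w e F G H => [|x w IH] e F G H.
  by rewrite linE /= !conv_one bmap_linl.
rewrite !linE !conv_cons.
have -> : (c *: F + H) \oo mul_letter x =
   c *: (F \oo mul_letter x) + (H \oo mul_letter x) by apply: linear_map_eq.
by rewrite 2!IH !linE !scalerDr !scalerA (mulrC c) addrACA.
Qed.
HB.instance Definition _ e G :=
  GRing.isLinear.Build K {linear SV -> U1} {linear SV -> W} _ (convr e G)
    (conv_linl e G).

Lemma convZl e c F G : conv e (c *: F) G = c *: conv e F G.
Proof. exact: (linearZZ (convr e G)). Qed.
Lemma convDl e F F' G : conv e (F + F') G = conv e F G + conv e F' G.
Proof. exact: (linearD (convr e G)). Qed.
Lemma conv0l e G : conv e 0 G = 0.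
Proof. exact: (linear0 (convr e G)). Qed.
Lemma conv0r e F : conv e F 0 = 0.
Proof. exact: (linear0 (conv e F)). Qed.
Lemma convBl e F F' G : conv e (F - F') G = conv e F G - conv e F' G.
Proof. exact: (linearB (convr e G)). Qed.
Lemma conv_suml e (I : Type) (r : seq I) (P : pred I)
    (F : I -> {linear SV -> U1}) G :
  conv e (\sum_(i <- r | P i) F i) G = \sum_(i <- r | P i) conv e (F i) G.
Proof. exact: (linear_sum (convr e G)). Qed.

(** The coproduct splits a word into two words of complementary lengths, so orders
    of vanishing add up; this makes the power series in R locally finite. *)
Lemma conv_order e (F : {linear SV -> U1}) (G : {linear SV -> U2}) m n w :
  (forall u, (size u < m)%N -> F (word u) = 0) ->
  (forall u, (size u < n)%N -> G (word u) = 0) ->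
  (size w < m + n)%N -> conv e F G (word w) = 0.
Proof.
elim: w e m n F G => [|x w IH] e m n F G hF hG /= lt_w.
  rewrite conv_one; case: m => [|m] in hF lt_w *; last by rewrite hF ?bmap0l.
  by rewrite hG ?bmap0r.
rewrite conv_cons (IH _ m.-1 n) ?(IH _ m n.-1) ?scaler0 ?addr0 //.
- by move=> u hu; rewrite /= lmul_word hG //= -ltn_predRL.
- by case: n {hG} lt_w => [|n] /=; rewrite ?addn0 ?addnS // => /ltnW.
- by move=> u hu; rewrite /= lmul_word hF //= -ltn_predRL.
by case: m {hF} lt_w => [|m] /=; rewrite ?addSn // => /ltnW.
Qed.

Lemma conv_eq_upto e F F' G G' w :
  (forall u, (size u <= size w)%N -> F (word u) = F' (word u)) ->
  (forall u, (size u <= size w)%N -> G (word u) = G' (word u)) ->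
  conv e F G (word w) = conv e F' G' (word w).
Proof.
elim: w e F F' G G' => [|x w IH] e F F' G G' hF hG /=.
  by rewrite !conv_one hF // hG.
rewrite !conv_cons; congr (_ *: _ + _); apply: IH => u hu.
- by rewrite /= lmul_word hF.
- by rewrite hG // ltnW.
- by rewrite hF // ltnW.
by rewrite /= lmul_word hG.
Qed.

End Conv.

Section Coder.
Variables (d : int) (Q : {linear SV -> SV}).
Hypothesis Qcoder : coderivation d Q.

(** A map of degree d commutes with the sign operator up to (-1)^(e d); a
    coderivation has degree d by its first clause. *)
Lemma coder_ksign e z : ksign e (Q z) = sgn K (e * d) *: Q (ksign e z).
Proof.
apply: (@pres_ext _ _ _ _ (@ksign _ V e \o Q)
  (sgn K (e * d) \*: (Q \o @ksign _ V e))) => w /=.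
have [s [hs Qw]] : sym_deg (wdeg w + d) (Q (word w)).
  apply: (proj1 Qcoder); exists [:: (1, w)]; split=> [c|].
    by rewrite inE => /eqP ->.
  by rewrite big_seq1 scale1r.
rewrite ksign_word linearZ /= scalerA Qw linear_sum scaler_sumr.
rewrite big_seq [RHS]big_seq; apply: eq_bigr => c /hs dc.
by rewrite linearZ /= ksign_word dc !scalerA mulrDr sgnD mulrC [X in X * _]mulrC.
Qed.

(** Coderivations of the coalgebra act as right derivations of the convolution
    product. *)
Lemma conv_precomp (U1 U2 W : lmodType K) (b : bilinear_map U1 U2 W) e
    (F : {linear SV -> U1}) (G : {linear SV -> U2}) :
  conv b e F G \oo Q =
  sgn K (e * d) *: conv b e (F \oo Q) G + conv b (e + d) F (G \oo Q).
Proof.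
apply: linear_map_eq => z; rewrite linE /= !convE (proj2 Qcoder).
by rewrite (@conv_coder _ _ _ _ _ d) //= => t; apply: coder_ksign.
Qed.

End Coder.
End Words.

(** * Coderivations are determined by their corestriction *)

Section Coderivations.
Variables (K : fieldType) (V : gradedSpace K).
Local Notation SV := (SymCoalg V).
Local Notation one := (word [::] : SV).

Definition lid (U : lmodType K) : {linear U -> U} := idfun.

Lemma conv_eql (U1 U2 W : lmodType K) (b : bilinear_map U1 U2 W) e
    (F F' : {linear SV -> U1}) (G : {linear SV -> U2}) :
  (forall u v, b (F u) v = b (F' u) v) -> conv b e F G = conv b e F' G.
Proof.
move=> FF'; apply: word_ext => w.
elim: w e F F' G FF' => [|x w IH] e F F' G FF'; first by rewrite !conv_one.
by rewrite !conv_cons; congr (_ *: _ + _); apply: IH => u v; apply: FF'.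
Qed.

Definition kmul : bilinear_map K^o K^o K^o :=
  @BilinearMap K K^o K^o K^o ( *%R )
    (fun v c x y => etrans (mulrDl _ _ v) (congr1 (+%R^~ _) (esym (mulrA c x v))))
    (fun u c x y => etrans (mulrDr u _ _) (congr1 (+%R^~ _) (mulrCA u c x))).

Lemma counit_mul_letter x : @counit K V \oo mul_letter x = 0.
Proof. by apply: word_ext => w; rewrite /= lmul_word counit_word. Qed.

Lemma conv_counitr (F : {linear SV -> K^o}) :
  conv kmul 0 F (@counit K V) = F.
Proof.
apply: word_ext => w; elim: w F => [|x w IH] F.
  by rewrite conv_one /= counit_word mulr1.
rewrite conv_cons counit_mul_letter conv0r linE addr0 mul0r sgn0 scale1r IH /=.
by rewrite lmul_word.
Qed.

Lemma conv_counitl e (F : {linear SV -> K^o}) :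
  conv kmul e (@counit K V) F = F.
Proof.
apply: word_ext => w; elim: w e F => [|x w IH] e F.
  by rewrite conv_one /= counit_word mul1r.
by rewrite conv_cons counit_mul_letter IH conv0l linE scaler0 add0r /= lmul_word.
Qed.

(** The counit is its own convolution square, so it is killed by the derivation
    F |-> F o Q: indeed eps o Q = eps o Q + eps o Q. *)
Lemma counit_coder d (Q : {linear SV -> SV}) :
  coderivation d Q -> @counit K V \oo Q = 0.
Proof.
move=> Qcoder; apply/eqP; rewrite -(inj_eq (addrI (@counit K V \oo Q))) addr0.
apply/eqP; have := conv_precomp Qcoder kmul 0 (@counit K V) (@counit K V).
by rewrite mul0r sgn0 scale1r conv_counitr conv_counitr conv_counitl.
Qed.

Section MulByLetterPart.
Variable t : SV.
(** The product u, t |-> pr_1(u) t, where pr_1 projects to words of length one: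
    it multiplies back a letter that the coproduct has split off. *)
Definition wmul1 (w : seq (letter V)) : SV :=
  if w is [:: x] then lmul x t else 0.
Fact mul1_kills : kills (@sym_rel K V) wmul1.
Proof.
apply: sym_kills => [a [|x0 [|x1 u]] [|y0 v] x y z h1 h2 h3|[|x0 [|x1 u]] v x y] //=;
  by rewrite ?scaler0 ?addr0 //; apply: lmul_lin.
Qed.
(* Locked so that simplification does not unfold the lift to representatives. *)
Definition mul1_fun : SV -> SV := locked (Defs.lift mul1_kills).
Lemma mul1_funE u : mul1_fun u = fsum wmul1 (repr u).
Proof. by rewrite /mul1_fun -lock. Qed.
Fact mul1_fun_linear : linear mul1_fun.
Proof. by rewrite /mul1_fun -lock; apply: linearP. Qed.
HB.instance Definition _ :=
  GRing.isLinear.Build K SV SV _ mul1_fun mul1_fun_linear.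
Lemma mul1_word w : mul1_fun (word w) = wmul1 w.
Proof. by rewrite /mul1_fun -lock; apply: lift_gen. Qed.
End MulByLetterPart.

Fact mul1_linl t : linear (mul1_fun t). Proof. exact: linearP. Qed.
Fact mul1_linr u : linear (fun t => mul1_fun t u).
Proof.
move=> c t1 t2.
apply: (@pres_ext _ _ _ _ (mul1_fun (c *: t1 + t2))
          (c *: (mul1_fun t1 : {linear SV -> SV}) + mul1_fun t2)) => w /=.
rewrite !mul1_word; case: w => [|x [|y w]] /=; rewrite ?scaler0 ?addr0 //.
by rewrite linearP.
Qed.
Definition mul1 : bilinear_map SV SV SV :=
  @BilinearMap K SV SV SV (fun u t => mul1_fun t u) mul1_linl mul1_linr.

Lemma lmul_lval0 (x : letter V) t : lval x = 0 -> lmul x t = 0.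
Proof.
move=> x0; rewrite (@lmul_lin _ _ (-1) x x x) // ?x0 ?scaler0 ?addr0 //.
by rewrite scaleN1r addNr.
Qed.

(** A combination of letters of one degree is again a letter. *)
Lemma letter_sum d (l : seq (K * letter V)) :
  (forall p, p \in l -> ldeg p.2 = d) ->
  exists x : letter V, [/\ ldeg x = d, lval x = \sum_(p <- l) p.1 *: lval p.2 &
    forall t, lmul x t = \sum_(p <- l) p.1 *: lmul p.2 t].
Proof.
elim: l => [|[c y] l IH] hl.
  have h0 : (0 : V) \in gdeg V d by rewrite rpred0.
  exists (Sub (d, 0 : V) h0); split=> [//||t]; rewrite big_nil //.
  exact: lmul_lval0.
have [x [dx vx mx]] := IH (fun p hp => hl p (mem_behead (s := _ :: _) hp)).
have dy : ldeg y = d by apply: (hl (c, y)); rewrite mem_head.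
have hz : c *: lval y + lval x \in gdeg V d.
  rewrite rpredD ?rpredZ //; first by rewrite -dy; exact: (valP y).
  by rewrite -dx; exact: (valP x).
exists (Sub (d, c *: lval y + lval x) hz); split=> [//||t].
  by rewrite big_cons -vx.
by rewrite big_cons -mx; apply: lmul_lin.
Qed.

Lemma sum_by_degree (W : zmodType) (l : seq (K * letter V))
    (F : K * letter V -> W) :
  \sum_(p <- l) F p =
  \sum_(d <- undup [seq ldeg p.2 | p <- l]) \sum_(p <- l | ldeg p.2 == d) F p.
Proof.
rewrite (exchange_big_dep xpredT) //= big_seq [RHS]big_seq.
apply: eq_bigr => p pl; rewrite -big_filter.
rewrite (_ : [seq d <- _ | _] = [:: ldeg p.2]) ?big_seq1 //.
rewrite (eq_filter (a2 := pred1 (ldeg p.2))); last by move=> d; rewrite /= eq_sym.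
rewrite filter_pred1_uniq ?undup_uniq // mem_undup.
exact: (map_f (fun p : K * letter V => ldeg p.2)).
Qed.

(** The corestriction is injective on the span of words of length one: group the
    letters by degree, add them up within each degree, and use that homogeneous
    components are independent. *)
Lemma mul1_corestr0 u t : corestr u = 0 -> mul1 u t = 0.
Proof.
pose sg (c : K * seq (letter V)) :=
  if c.2 is [:: x] then Some (c.1, x) else None.
pose l := pmap sg (repr u).
have mul1E : mul1 u t = \sum_(p <- l) p.1 *: lmul p.2 t.
  rewrite /= mul1_funE /fsum /l.
  elim: (repr u) => [|[c w] s IH]; rewrite ?big_nil // big_cons IH.
  by case: w => [|x [|y w]] /=; rewrite ?big_cons ?scaler0 ?add0r.
have corE : corestr u = \sum_(p <- l) p.1 *: lval p.2.
  rewrite -[LHS]/(fsum (@wcorestr _ V) (repr u)) /fsum /l.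
  elim: (repr u) => [|[c w] s IH]; rewrite ?big_nil // big_cons IH.
  by case: w => [|x [|y w]] /=; rewrite ?big_cons ?scaler0 ?add0r.
rewrite mul1E corE !sum_by_degree => h0.
have hx d : exists x : letter V, [/\ ldeg x = d,
    lval x = \sum_(p <- l | ldeg p.2 == d) p.1 *: lval p.2 &
    forall t, lmul x t = \sum_(p <- l | ldeg p.2 == d) p.1 *: lmul p.2 t].
  have [|x [dx vx mx]] := @letter_sum d [seq p <- l | ldeg p.2 == d].
    by move=> p; rewrite mem_filter => /andP[/eqP].
  by exists x; split=> [//||s]; rewrite ?vx ?mx big_filter.
have [X hX] := choice hx.
rewrite big_seq big1 // => d dl; have [dX vX mX] := hX d.
rewrite -mX lmul_lval0 //.
apply: (@gdeg_indep _ V _ (fun d => lval (X d)) (undup_uniq _) _ _ d dl).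
  move=> e; have [de _ _] := hX e; have := valP (X e).
  by rewrite -[(val (X e)).1]/(ldeg (X e)) de.
by rewrite -[RHS]h0; apply: eq_bigr => e _; have [_ -> _] := hX e.
Qed.

(** Splitting off one letter and multiplying it back counts letters: this operator
    is multiplication by the length (euler_word). *)
Definition euler : {linear SV -> SV} := conv mul1 0 (lid SV) (lid SV).

Lemma conv_mul1_letter e x (G : {linear SV -> SV}) :
  conv mul1 e (mul_letter x) G = mul_letter x \oo G.
Proof.
apply: word_ext => w; elim: w e G => [|y w IH] e G.
  by rewrite conv_one /= lmul_word mul1_word.
rewrite conv_cons IH /= lmul_word (@conv_eql _ _ _ _ _ _ 0).
  by rewrite conv0l linE scaler0 add0r.
move=> u v; rewrite bmap0l /=.
apply: (@pres_ext _ _ _ _ (mul1_fun v \o mul_letter x \o mul_letter y) \0) => w' /=.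
by rewrite !lmul_word mul1_word.
Qed.

Lemma euler_mul_letter x :
  euler \oo mul_letter x = mul_letter x + mul_letter x \oo euler.
Proof.
rewrite /euler conv_mul_letter mul0r sgn0 scale1r add0r.
rewrite (_ : lid SV \oo mul_letter x = mul_letter x); last exact: linear_map_eq.
rewrite conv_mul1_letter; congr (_ + _); first exact: linear_map_eq.
apply: linear_map_eq => z; rewrite /= !convE.
pose f1 : {linear tensor SV SV -> SV} :=
  on_tensor mul1 \oo tmap (lid SV \oo @ksign _ V (ldeg x)) (mul_letter x).
pose f2 : {linear tensor SV SV -> SV} :=
  mul_letter x \oo on_tensor mul1 \oo tmap (lid SV \oo @ksign _ V 0) (lid SV).
suff /(congr1 (fun f : {linear _ -> _} => f (coprod z))) : f1 = f2 by [].
apply: tensor_hom_ext => u v /=; rewrite !tmap_tens !on_tensor_tens /=.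
apply: (@pres_ext _ _ _ _ (mul1_fun (mul_letter x v) \o @ksign _ V (ldeg x))
  (mul_letter x \o mul1_fun v \o @ksign _ V 0)) => w /=.
rewrite !ksign_word mul0r sgn0 scale1r linearZ /= !mul1_word.
case: w => [|y [|z' w]] /=; rewrite ?linear0 ?scaler0 //.
by rewrite (lmul_swap x y) /wdeg big_seq1.
Qed.

Lemma euler_word w : euler (word w) = (size w)%:R *: word w.
Proof.
elim: w => [|x w IH]; first by rewrite /euler conv_one /= mul1_word scale0r.
rewrite -lmul_word -[LHS]/((euler \oo mul_letter x) (word w)) euler_mul_letter.
by rewrite linE /= IH linearZ /= lmul_word -mulr_natl mulrSr addrC scalerDl scale1r mulr1.
Qed.

End Coderivations.

Section Uniqueness.
Variables (K : fieldType) (V : gradedSpace K).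
Local Notation SV := (SymCoalg V).
Local Notation one := (word [::] : SV).
Hypothesis charK : [pchar K] =i pred0.

Lemma natf_neq0 n : (n.+1)%:R != 0 :> K.
Proof. by rewrite (pcharf0P K).1. Qed.

(** In characteristic zero the length is invertible off the empty word, where the
    counit takes over. *)
Lemma euler_ker0 (z : SV) : euler V z = 0 -> counit z = 0 -> z = 0.
Proof.
pose inv_euler (w : seq (letter V)) : SV := (size w)%:R^-1 *: word w.
have inv_kills : kills (@sym_rel K V) inv_euler.
  apply: sym_kills => [a u v x y z' h1 h2 h3|u v x y]; rewrite /inv_euler !size_cat /=.
    by rewrite (word_lin _ _ h1 h2 h3) scalerDr !scalerA mulrC.
  by rewrite word_swap !scalerA mulrC.
pose f1 : {linear SV -> SV} := Defs.lift inv_kills.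
have unit_lin : linear (fun k : K^o => (k : K) *: one).
  by move=> a k l; rewrite scalerDl scalerA.
pose unit : {linear K^o -> SV} :=
  HB.pack (fun k : K^o => (k : K) *: one) (GRing.isLinear.Build K K^o SV _ _ unit_lin).
have decomp : f1 \oo euler V + unit \oo @counit K V = lid SV.
  apply: word_ext => w; rewrite linE /= counit_word euler_word linearZ.
  rewrite [f1 _]lift_gen; case: w => [|x w] /=.
    by rewrite scale0r add0r scale1r.
  by rewrite scale0r addr0 scalerA mulfV ?scale1r ?natf_neq0.
move=> ez cz; rewrite -[z]/(lid SV z) -decomp linE /= ez cz.
by rewrite (linear0 f1) scale0r addr0.
Qed.

(** Let G be the difference of the two coderivations.  Applying G as a derivation
    to euler = pr_1 * id leaves pr_1 * G, because pr_1 G = 0; on a word of length n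
    the right-hand side only involves G on shorter words. *)
Lemma coderivation_ext d (Q Q' : {linear SV -> SV}) :
  coderivation d Q -> coderivation d Q' ->
  (forall w, corestr (Q (word w)) = corestr (Q' (word w))) -> Q = Q'.
Proof.
move=> hQ hQ' eqc; apply/eqP; rewrite -subr_eq0; apply/eqP.
(* Only the term in which G hits the second factor survives. *)
have Nx z : euler V ((Q - Q') z) =
    conv (mul1 V) d (lid SV) (Q - Q') z.
  have mul10 : conv (mul1 V) 0 (Q - Q') (lid SV) = 0.
    rewrite (@conv_eql _ _ _ _ _ _ _ _ 0) ?conv0l // => u v.
    rewrite bmap0l; apply: mul1_corestr0.
    rewrite linE linearB; apply/eqP; rewrite subr_eq0; apply/eqP.
    exact: (@pres_ext _ _ _ _ (@corestr _ V \o Q) (@corestr _ V \o Q')).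
  have := conv_precomp hQ (mul1 V) 0 (lid SV) (lid SV).
  have := conv_precomp hQ' (mul1 V) 0 (lid SV) (lid SV).
  rewrite !mul0r sgn0 !scale1r !add0r => e' e.
  have lidQ (R : {linear SV -> SV}) : lid SV \oo R = R by apply: linear_map_eq.
  have : euler V \oo (Q - Q') = euler V \oo Q - euler V \oo Q'.
    exact: linearB.
  rewrite e e' !lidQ opprD addrACA -convBl mul10 add0r -linearB.
  by move/(congr1 (fun f : {linear SV -> SV} => f z)).
apply: word_ext => w; rewrite [RHS]linE.
have [n] := ubnP (size w); elim: n w => // n IH w; rewrite ltnS => sz_w.
apply: euler_ker0.
  (* Replacing the first factor by pr_1 gives it order of vanishing one. *)
  rewrite Nx -(@conv_eql _ _ _ _ _ _ _ (mul1_fun one : {linear SV -> SV})).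
    apply: (@conv_order _ _ _ _ _ _ _ _ _ 1 (size w)) => // u sz_u.
      by case: u sz_u => // _; rewrite /= mul1_word.
    by rewrite IH // (leq_trans sz_u).
  move=> u v /=.
  apply: (@pres_ext _ _ _ _ (mul1_fun v \o mul1_fun one) (mul1_fun v)) => {sz_w}w /=.
  rewrite !mul1_word; case: w => [|x [|y w]] /=; rewrite ?linear0 //.
  by rewrite lmul_word mul1_word.
rewrite linE linearB /= -[counit (Q _)]/((@counit K V \oo Q) (word w)).
rewrite -[counit (Q' _)]/((@counit K V \oo Q') (word w)).
by rewrite (counit_coder hQ) (counit_coder hQ') subrr.
Qed.

End Uniqueness.

(** * The commutator of two coderivations *)

Section Commutator.

Lemma cross_terms_cancel (G : zmodType) (x y z t x' t' : G) :
  x + y + (z + t) - (x' + z + (y + t')) = x - x' + (t - t').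
Proof.
rewrite [z + t]addrC [x + y + _]addrACA [y + t']addrC [x' + z + _]addrACA.
by rewrite [z + y]addrC opprD [LHS]addrACA subrr addr0 opprD [LHS]addrACA.
Qed.
Variables (K : fieldType) (V : gradedSpace K).
Local Notation SV := (SymCoalg V).

Lemma tensBl (u1 u2 v : SV) : tens (u1 - u2) v = tens u1 v - tens u2 v.
Proof.
by rewrite -scaleN1r addrC tensDl scaleN1r addrC.
Qed.

Lemma tensBr (u v1 v2 : SV) : tens u (v1 - v2) = tens u v1 - tens u v2.
Proof.
by rewrite -scaleN1r addrC tensDr scaleN1r addrC.
Qed.

Lemma sym_degP c e (x y : SV) :
  sym_deg e x -> sym_deg e y -> sym_deg e (c *: x + y).
Proof.
move=> [s [hs ->]] [t [ht ->]]; exists (scale_seq c s ++ t); split=> [p|].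
  rewrite mem_cat => /orP[/mapP[q qs ->]|]; [exact: (hs q)|exact: ht].
rewrite big_cat big_map scaler_sumr; congr (_ + _).
by apply: eq_bigr => p _; rewrite scalerA.
Qed.

(** In the commutator of the two operators Q_i (x) 1 + 1 (x) Q_i the mixed terms
    cancel (cross_terms_cancel), thanks to the Koszul sign carried by ksign. *)
Lemma coderivation_gcomm d1 d2 (Q1 Q2 : {linear SV -> SV}) :
  coderivation d1 Q1 -> coderivation d2 Q2 ->
  coderivation (d1 + d2) (gcomm d1 d2 Q1 Q2).
Proof.
move=> h1 h2; split=> [e x xe|z].
  change (sym_deg (e + (d1 + d2)) (gcomm d1 d2 Q1 Q2 x)).
  have -> : gcomm d1 d2 Q1 Q2 x =
      (- sgn K (d1 * d2)) *: Q2 (Q1 x) + Q1 (Q2 x).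
    by rewrite /gcomm scaleNr addrC.
  apply: sym_degP.
    by rewrite addrA; apply: (proj1 h2); apply: (proj1 h1).
  by rewrite [d1 + _]addrC addrA; apply: (proj1 h1); apply: (proj1 h2).
rewrite /= /gcomm linearB linearZ /= (proj2 h1) (proj2 h2) (proj2 h2) (proj2 h1).
pose TT : lmodType K := tensor SV SV.
pose dd (d : int) (Q : {linear SV -> SV}) : {linear TT -> TT} :=
  (tmap Q (lid SV) : {linear TT -> TT}) + (tmap (@ksign _ V d) Q : {linear TT -> TT}).
pose g1 := dd d1 Q1 \oo dd d2 Q2 - sgn K (d1 * d2) *: (dd d2 Q2 \oo dd d1 Q1).
pose g2 := dd (d1 + d2) (gcomm d1 d2 Q1 Q2).
suff /(congr1 (fun f : {linear TT -> TT} => f (coprod z))) : g1 = g2 by [].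
apply: tensor_hom_ext => u v.
rewrite /g1 /g2 /dd !linE /= !tmap_tens !linearD /= !tmap_tens /=.
rewrite (coder_ksign h1) (coder_ksign h2) ksignD (ksignC d2 d1) /gcomm.
rewrite !tensBl !tensBr !tensZl !tensZr !scalerA.
rewrite [d2 * d1]mulrC sgn_sqr scale1r -!opprD.
exact: cross_terms_cancel.
Qed.
End Commutator.

(** * The convolution Lie algebra *)

Fact add_jacobi_terms (G : zmodType) (a b c d e f : G) :
  a + b + (c + d) + (e + f) = a + (c + e) + (b + f + d).
Proof. by rewrite (addrACA a) (addrACA (a + c)) -(addrA a) (addrAC b d). Qed.

Section LieConv.
Variables (K : fieldType) (M : gradedLie K) (V : gradedSpace K).
Local Notation SV := (SymCoalg V).
Local Notation one := (word [::] : SV).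
Local Notation hom := {linear SV -> M}.

Definition lie_bilinear : bilinear_map M M M := BilinearMap (@br_linl K M) (@br_linr K M).
Definition lie (e : int) : hom -> hom -> hom := conv lie_bilinear e.
HB.instance Definition _ e F := GRing.Linear.on (lie e F).

Lemma lie_one e F G : lie e F G one = br (F one) (G one).
Proof. exact: conv_one. Qed.
Lemma lie_cons e F G x w :
  lie e F G (word (x :: w)) =
  sgn K (e * ldeg x) *: lie e (F \oo mul_letter x) G (word w) +
  lie (e + ldeg x) F (G \oo mul_letter x) (word w).
Proof. exact: conv_cons. Qed.
Lemma lie_mul e F G x :
  lie e F G \oo mul_letter x =
  sgn K (e * ldeg x) *: lie e (F \oo mul_letter x) G +
  lie (e + ldeg x) F (G \oo mul_letter x).
Proof. exact: conv_mul_letter. Qed.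
Lemma lieDl e F F' G : lie e (F + F') G = lie e F G + lie e F' G.
Proof. exact: convDl. Qed.
Lemma lieZl e c F G : lie e (c *: F) G = c *: lie e F G.
Proof. exact: convZl. Qed.
Lemma lieBl e F F' G : lie e (F - F') G = lie e F G - lie e F' G.
Proof. exact: convBl. Qed.
Lemma lie_suml e (I : Type) (r : seq I) (P : pred I) (F : I -> hom) G :
  lie e (\sum_(i <- r | P i) F i) G = \sum_(i <- r | P i) lie e (F i) G.
Proof. exact: conv_suml. Qed.
Lemma lieDr e F G G' : lie e F (G + G') = lie e F G + lie e F G'.
Proof. exact: linearD. Qed.
Lemma lieZr e c F G : lie e F (c *: G) = c *: lie e F G.
Proof. exact: linearZZ. Qed.
Lemma lieBr e F G G' : lie e F (G - G') = lie e F G - lie e F G'.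
Proof. exact: linearB. Qed.

(** F has degree f; it is enough to test words, which are homogeneous. *)
Definition hom_deg (f : int) (F : hom) := forall w, F (word w) \in gdeg M (f + wdeg w).

Lemma hom_deg_mul f F x : hom_deg f F -> hom_deg (f + ldeg x) (F \oo mul_letter x).
Proof. by move=> hF w; rewrite /= lmul_word -addrA -wdeg_cons. Qed.

Lemma hom_deg_one f F : hom_deg f F -> F one \in gdeg M f.
Proof. by move/(_ [::]); rewrite /wdeg big_nil addr0. Qed.

Lemma hom_degD f F G : hom_deg f F -> hom_deg f G -> hom_deg f (F + G).
Proof. by move=> hF hG w; rewrite linE rpredD. Qed.

Lemma lie_deg f e F G : hom_deg f F -> hom_deg e G -> hom_deg (f + e) (lie e F G).
Proof.
move=> hF hG w; elim: w f e F G hF hG => [|x w IH] f e F G hF hG.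
  by rewrite lie_one /wdeg big_nil addr0 br_deg ?hom_deg_one.
rewrite lie_cons wdeg_cons rpredD ?rpredZ //.
  rewrite addrA [f + e + _]addrAC; apply: IH => //; exact: hom_deg_mul.
rewrite addrA -[f + e + _]addrA; apply: IH => //; exact: hom_deg_mul.
Qed.

Lemma lie_anti f e F G : hom_deg f F -> hom_deg e G ->
  lie e F G = - (sgn K (f * e) *: lie f G F).
Proof.
move=> hF hG; apply: word_ext => w; elim: w f e F G hF hG => [|x w IH] f e F G hF hG.
  by rewrite !linE !lie_one; apply: br_anti; apply: hom_deg_one.
rewrite !linE !lie_cons.
rewrite (IH (f + ldeg x) e (F \oo mul_letter x) G) ?hom_deg_mul //; last exact: hom_deg_mul.
rewrite (IH f (e + ldeg x) F (G \oo mul_letter x)) //; last exact: hom_deg_mul.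
rewrite !linE scalerN -opprD !scalerDr !scalerA; congr (- _).
rewrite addrC mulrDr mulrDl !sgnD; congr (_ *: _ + _ *: _).
by rewrite mulrCA [ldeg x * e]mulrC sgn_sqr mulr1.
Qed.

(** The Jacobi identity in the form: bracketing on the right with H is a
    derivation. *)
Lemma lie_jacobi f e h F G H : hom_deg f F -> hom_deg e G -> hom_deg h H ->
  lie h (lie e F G) H =
  lie (e + h) F (lie h G H) + sgn K (e * h) *: lie e (lie h F H) G.
Proof.
move=> hF hG hH; apply: word_ext => w.
elim: w f e h F G H hF hG hH => [|x w IH] f e h F G H hF hG hH.
  rewrite !linE !lie_one /=.
  have := br_jacobi (H one) (hom_deg_one hF) (hom_deg_one hG) => ->.
  have := br_anti (hom_deg_one hG) (br_deg (hom_deg_one hF) (hom_deg_one hH)) => ->.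
  rewrite scalerN scalerA [e * (f + h)]mulrDr sgnD [e * f]mulrC sgnK.
  by rewrite subrK.
have hFx := hom_deg_mul x hF; have hGx := hom_deg_mul x hG.
have hHx := hom_deg_mul x hH.
rewrite !linE !lie_cons !lie_mul !lieDl !lieDr !lieZl !lieZr !linE.
rewrite (IH _ _ _ _ _ _ hFx hG hH) (IH _ _ _ _ _ _ hF hGx hH).
rewrite (IH _ _ _ _ _ _ hF hG hHx) !linE.
rewrite !scalerDr !scalerA.
rewrite (addrA e h) [e + ldeg x + h]addrAC add_jacobi_terms.
rewrite !mulrDl !mulrDr !sgnD [ldeg x * h]mulrC.
congr (_ *: _ + _ + (_ *: _ + _ + _ *: _)).
- exact: mulrC.
- by rewrite [LHS]mulrC [sgn K (e * ldeg x) * _]mulrC.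
- by rewrite [LHS]mulrC -mulrA sgn_sqr mulr1.
Qed.

(** From here on a plays the part of the generic point: an element of degree 0 that
    vanishes on the empty word. *)
Variable a : hom.
Hypothesis a_deg : hom_deg 0 a.
Hypothesis a_one : a one = 0.

(** Right bracketing with a, that is - ad a.  As a has degree 0, no sign occurs. *)
Definition adr : hom -> hom := convr lie_bilinear 0 a.
HB.instance Definition _ := GRing.Linear.on adr.
Definition adr_iter k F := iter k adr F.

Fact adr_iter_linear k : linear (adr_iter k).
Proof. by move=> c F G; elim: k => //= k ->; rewrite linearP. Qed.
HB.instance Definition _ k := GRing.isLinear.Build K hom hom _ (adr_iter k) (adr_iter_linear k).

Lemma adr_iterSr k F : adr_iter k.+1 F = adr_iter k (adr F). Proof. exact: iterSr. Qed.
Lemma adr_iter_add k l F : adr_iter (k + l) F = adr_iter k (adr_iter l F). Proof. exact: iterD. Qed.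

Lemma adr_deg f F : hom_deg f F -> hom_deg f (adr F).
Proof. by move=> hF; rewrite -[f]addr0; apply: lie_deg. Qed.

Lemma adr_iter_deg k f F : hom_deg f F -> hom_deg f (adr_iter k F).
Proof. by move=> hF; elim: k => //= k; apply: adr_deg. Qed.

Lemma adr_lie f e F G : hom_deg f F -> hom_deg e G ->
  adr (lie e F G) = lie e (adr F) G + lie e F (adr G).
Proof.
move=> hF hG; rewrite [LHS](lie_jacobi hF hG a_deg) addr0 mulr0 sgn0 scale1r.
exact: addrC.
Qed.

Lemma adr_iter_order k F w : (size w < k)%N -> adr_iter k F (word w) = 0.
Proof.
elim: k w => // k IH w sz_w.
apply: (@conv_order _ _ _ _ _ _ _ _ _ k 1) => //; last by rewrite addn1.
by case=> // _; apply: a_one.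
Qed.

Lemma adr_iter_eq_upto k (F F' : hom) w :
  (forall u, (size u <= size w)%N -> F (word u) = F' (word u)) ->
  adr_iter k F (word w) = adr_iter k F' (word w).
Proof.
elim: k w => [|k IH] w eqF; first exact: eqF.
apply: conv_eq_upto => // u hu; apply: IH => v hv.
by apply: eqF; apply: leq_trans hu.
Qed.

(** The series sum_k c_k R^k, cut off at the length of the word; by adr_iter_order
    any later cut-off gives the same value (ser_word). *)
Definition wser (c : nat -> K) (F : hom) (w : seq (letter V)) : M :=
  \sum_(k < (size w).+1) c k *: adr_iter k F (word w).

Fact ser_kills c F : kills (@sym_rel K V) (wser c F).
Proof.
apply: sym_kills => [b u v x y z h1 h2 h3|u v x y]; rewrite /wser !size_cat /=.
  rewrite scaler_sumr -big_split; apply: eq_bigr => k _ /=.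
  by rewrite (word_lin _ _ h1 h2 h3) linearP scalerDr !scalerA mulrC.
rewrite scaler_sumr; apply: eq_bigr => k _ /=.
by rewrite word_swap linearZ /= !scalerA mulrC.
Qed.

Definition ser c F : hom := locked (Defs.lift (ser_kills c F) : hom).

Lemma ser_wser c F w : ser c F (word w) = wser c F w.
Proof. by rewrite /ser -lock; apply: lift_gen. Qed.

Lemma ser_word c F N w : (size w < N)%N ->
  ser c F (word w) = (\sum_(k < N) c k *: adr_iter k F) (word w).
Proof.
move=> ltN; rewrite ser_wser linE /wser.
rewrite (big_ord_widen N (fun k => c k *: adr_iter k F (word w))) // big_mkcond.
apply: eq_bigr => k _; rewrite linE ltnS; case: leqP => // h.
by rewrite adr_iter_order ?scaler0.
Qed.

Fact ser_linear c : linear (ser c).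
Proof.
move=> b F G; apply: word_ext => w.
rewrite !linE !ser_wser /wser scaler_sumr -big_split.
by apply: eq_bigr => k _; rewrite linearP !linE scalerDr !scalerA mulrC.
Qed.
HB.instance Definition _ c := GRing.isLinear.Build K hom hom _ (ser c) (ser_linear c).

(** On an arbitrary element of the coalgebra, which may mix lengths, the partial
    sums are eventually constant.  This is what lets a derivation such as
    F |-> F o Q, which does not preserve length, be applied term by term. *)
Lemma ser_eval c F z :
  exists N0, forall N, (N0 <= N)%N -> ser c F z = (\sum_(k < N) c k *: adr_iter k F) z.
Proof.
exists (\max_(p <- repr z) (size p.2).+1)%N => N hN.
rewrite -[z]Defs.class_repr class_fsum /fsum !linear_sum.
rewrite big_seq [RHS]big_seq; apply: eq_bigr => p pz; rewrite !linearZ.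
congr (_ *: _); apply: (@ser_word c F N p.2).
by apply: leq_trans hN; apply: (@leq_bigmax_seq _ _ xpredT (fun p => (size p.2).+1)).
Qed.

Lemma ser_deg c f F : hom_deg f F -> hom_deg f (ser c F).
Proof.
move=> hF w; rewrite (ser_word _ _ (ltnSn _)) linE rpred_sum // => k _.
by rewrite linE rpredZ // adr_iter_deg.
Qed.

Lemma adr_ser c F : adr (ser c F) = ser c (adr F).
Proof.
apply: word_ext => w; rewrite (ser_word _ _ (ltnSn (size w))).
transitivity (adr (\sum_(k < (size w).+1) c k *: adr_iter k F) (word w)).
  by apply: (@adr_iter_eq_upto 1) => u hu; apply: ser_word.
rewrite linear_sum; congr (GRing.Linear.sort _ (word w)).
by apply: eq_bigr => k _; rewrite linearZ /= -adr_iterSr.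
Qed.

Lemma adr_iter_ser c k F : adr_iter k (ser c F) = ser c (adr_iter k F).
Proof. by elim: k => //= k ->; rewrite adr_ser. Qed.

End LieConv.

(** A double sum over a square equals the sum over the antidiagonals n = k + l < N
    when the terms beyond them vanish. *)
Lemma triangle_sum (G : zmodType) (T : nat -> nat -> G) N :
  (forall k l, (N <= k + l)%N -> T k l = 0) ->
  \sum_(k < N) \sum_(l < N) T k l =
  \sum_(n < N) \sum_(p < n.+1) T p (n - p)%N.
Proof.
move=> T0; transitivity (\sum_(n < N) \sum_(p < N | (p <= n)%N) T p (n - p)%N).
  rewrite [RHS](exchange_big_dep xpredT) //=; apply: eq_bigr => k _.
  rewrite -(big_mkord (fun n => k <= n)%N (fun n => T k (n - k)%N)).
  rewrite -(big_nat_widenl k 0 N xpredT (fun n => T k (n - k)%N)) //.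
  rewrite -{2}[k : nat]add0n big_addn -(big_mkord xpredT (T k)).
  rewrite (big_cat_nat _ (leq_subr k N)) //=.
  rewrite [X in _ + X]big1_seq ?addr0 => [|l].
    by apply: eq_bigr => l _; rewrite addnK.
  rewrite mem_index_iota /= => /andP[h _]; apply: T0.
  by rewrite -leq_subLR.
apply: eq_bigr => n _.
by rewrite (big_ord_widen N (fun p => T p (n - p)%N)).
Qed.

(** The induction step of adr_iter applied to a product, by Pascal's rule. *)
Lemma pascal_sum (G : zmodType) (T : nat -> nat -> G) n :
  \sum_(p < n) (T p.+1 (n.-1 - p)%N + T p (n.-1 - p).+1) *+ 'C(n, p) + T n 0%N =
  \sum_(p < n.+1) T p (n - p)%N *+ 'C(n.+1, p).
Proof.
have subS (p : 'I_n) : ((n.-1 - p).+1 = n - p)%N.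
  by case: n p => [[]//|n] p /=; rewrite subSn // -ltnS.
rewrite [RHS]big_ord_recl /= bin0 mulr1n subn0.
rewrite (eq_bigr (fun p : 'I_n => T p.+1 (n.-1 - p)%N *+ 'C(n, p) +
   T p (n - p)%N *+ 'C(n, p))); last first.
  by move=> p _; rewrite mulrnDl subS.
rewrite big_split /= -addrA.
have -> : \sum_(p < n) T p (n - p)%N *+ 'C(n, p) + T n 0%N =
    \sum_(p < n.+1) T p (n - p)%N *+ 'C(n, p).
  by rewrite big_ord_recr /= binn subnn.
rewrite [X in _ + X]big_ord_recl /= bin0 mulr1n subn0 addrCA; congr (_ + _).
rewrite -big_split; apply: eq_bigr => p _ /=.
by rewrite /bump /= !add1n !subnS -(subS p) /= binS mulrnDr addrC.
Qed.

(** * Power series in the right bracketing operator *)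

Section Series.
Variables (K : fieldType) (M : gradedLie K) (V : gradedSpace K).
Local Notation SV := (SymCoalg V).
Local Notation one := (word [::] : SV).
Local Notation hom := {linear SV -> M}.
Variable a : hom.
Hypothesis a_deg : hom_deg 0 a.
Hypothesis a_one : a one = 0.
Local Notation adr := (adr a).
Local Notation adr_iter := (adr_iter a).
Local Notation ser := (ser a).

(** The double series sum c_(k,l) [R^k F, R^l G], over k + l < N. *)
Definition brsum (N : nat) (c : nat -> nat -> K) e (F G : hom) : hom :=
  \sum_(n < N) \sum_(p < n.+1) c p (n - p)%N *: lie e (adr_iter p F) (adr_iter (n - p) G).

Lemma lie_order k l e (F G : hom) w : (size w < k + l)%N ->
  lie e (adr_iter k F) (adr_iter l G) (word w) = 0.
Proof. by apply: conv_order => u hu; apply: adr_iter_order. Qed.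

Lemma lie_ser c c' e (F G : hom) w N : (size w < N)%N ->
  lie e (ser c F) (ser c' G) (word w) =
  brsum N (fun k l => c k * c' l) e F G (word w).
Proof.
move=> hN; transitivity (lie e (\sum_(k < N) c k *: adr_iter k F)
                               (\sum_(l < N) c' l *: adr_iter l G) (word w)).
  by apply: conv_eq_upto => u hu; apply: ser_word => //; apply: leq_ltn_trans hN.
rewrite lie_suml linE.
under eq_bigr do rewrite linear_sum linE.
rewrite (triangle_sum (T := fun k l => lie e (c k *: adr_iter k F) (c' l *: adr_iter l G) (word w))) => [|k l hkl].
  rewrite /brsum !linE; apply: eq_bigr => n _; rewrite linE; apply: eq_bigr => p _.
  by rewrite lieZl lieZr scalerA.
by rewrite lieZl lieZr !linE lie_order ?scaler0 // (leq_trans hN).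
Qed.

(** Composition of series is the Cauchy product of the coefficients. *)
Lemma ser_ser c c' (F : hom) :
  ser c (ser c' F) = ser (fun n => \sum_(p < n.+1) c p * c' (n - p)%N) F.
Proof.
apply: word_ext => w; rewrite !(ser_word a_one _ _ (ltnSn (size w))) !linE.
transitivity (\sum_(k < (size w).+1) \sum_(l < (size w).+1)
   (c k * c' l) *: adr_iter (k + l) F (word w)).
  apply: eq_bigr => k _; rewrite linE adr_iter_ser // (ser_word a_one _ _ (ltnSn (size w))).
  rewrite linE scaler_sumr; apply: eq_bigr => l _.
  by rewrite linE scalerA -adr_iter_add addnC.
rewrite (triangle_sum (T := fun k l => (c k * c' l) *: adr_iter (k + l) F (word w))).
  apply: eq_bigr => n _; rewrite linE scaler_suml; apply: eq_bigr => p _.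
  by rewrite subnKC // -ltnS.
by move=> k l hkl; rewrite adr_iter_order // scaler0.
Qed.

Lemma ser_id c (F : hom) : (forall n, c n = (n == 0%N)%:R) -> ser c F = F.
Proof.
move=> hc; apply: word_ext => w; rewrite (ser_word a_one _ _ (ltnSn (size w))).
rewrite linE big_ord_recl big1 ?addr0 => [|k _]; rewrite linE hc ?scale0r //=.
by rewrite scale1r.
Qed.

(** Each value of dl F on a word depends on F through a single element z of the
    coalgebra: the continuity needed to differentiate a series termwise.  Take
    z = Q w for F |-> F o Q, and z = w for F |-> D o F. *)
Definition is_local (dl : {linear hom -> hom}) :=
  forall w, exists z, forall F F' : hom, F z = F' z -> dl F (word w) = dl F' (word w).

Section Derivation.
Variables (d : int) (c : K) (dl : {linear hom -> hom}) (f : int) (F y : hom).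
Hypothesis F_deg : hom_deg f F.
Hypothesis y_deg : hom_deg d y.
Hypothesis dl_adr : forall G, hom_deg f G -> dl (adr G) = adr (dl G) + c *: lie d G y.

(** The derivation dl does not commute with R but dl R = R dl + c [., y] where
    y = dl a; iterating gives binomial coefficients. *)
Lemma der_adr_iter n : dl (adr_iter n F) = adr_iter n (dl F) +
  c *: \sum_(p < n) lie d (adr_iter p F) (adr_iter (n.-1 - p) y) *+ 'C(n, p).
Proof.
elim: n => [|n IH]; first by rewrite big_ord0 scaler0 addr0.
rewrite /= dl_adr; last exact: adr_iter_deg.
rewrite IH linearD linearZ /= -addrA -scalerDr; congr (_ + _ *: _).
rewrite -(pascal_sum (fun k l => lie d (adr_iter k F) (adr_iter l y))).
rewrite linear_sum; congr (_ + _); apply: eq_bigr => p _.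
rewrite linearMn; congr (_ *+ _).
by rewrite /= (adr_lie a_deg (adr_iter_deg a_deg _ F_deg) (adr_iter_deg a_deg _ y_deg)).
Qed.

Hypothesis dl_local : is_local dl.

Lemma der_ser b w : exists N0, forall N, (N0 <= N)%N ->
  dl (ser b F) (word w) = (ser b (dl F) +
   c *: brsum N (fun k l => b (k + l).+1 *+ 'C((k + l).+1, k)) d F y) (word w).
Proof.
have [z hz] := dl_local w; have [N0 hN0] := ser_eval a_one b F z.
exists (maxn N0 (size w)) => N; rewrite geq_max => /andP[hN hw].
rewrite (hz _ _ (hN0 N.+1 (leqW hN))) linear_sum.
have sz : (size w < N.+1)%N by [].
rewrite linE [X in X + _](ser_word a_one _ _ sz) !linE.
under eq_bigr do rewrite linearZ /= der_adr_iter linE linE scalerDr.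
rewrite big_split; congr (_ + _).
rewrite big_ord_recl big_ord0 !linE /= scaler0 scaler0 add0r scaler_sumr.
apply: eq_bigr => n _ /=; change (bump 0 n) with n.+1.
rewrite !linE !scaler_sumr; apply: eq_bigr => p _.
rewrite subnKC; last by rewrite -ltnS.
by rewrite add0n -scaler_nat !linE !scalerA mulrCA mulr_natr.
Qed.

End Derivation.

Hypothesis charK : [pchar K] =i pred0.

Definition theta_coef (k : nat) : K := (k.+1`!%:R)^-1.

Lemma bin_inv_fact k l :
  ((k + l)`!%:R)^-1 *+ 'C(k + l, k) = (k`!%:R)^-1 * (l`!%:R)^-1 :> K.
Proof.
rewrite -[LHS]mulr_natl -(bin_fact (leq_addr l k)) addKn natrM invfM mulrA mulfV.
  by rewrite mul1r natrM invfM.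
by rewrite (pcharf0P K).1 // -lt0n bin_gt0 leq_addr.
Qed.

(** Pascal's rule C(n+1, k) + C(n+1, l) = C(n+2, k+1) for n = k + l, divided by
    (n+2)!. *)
Lemma theta_coefM k l :
  theta_coef (k + l).+1 *+ 'C((k + l).+1, k) +
  theta_coef (l + k).+1 *+ 'C((l + k).+1, l) = theta_coef k * theta_coef l.
Proof.
have -> : 'C((l + k).+1, l) = 'C((k + l).+1, k.+1).
  by rewrite [(l + k)%N]addnC -addSn -(bin_sub (leq_addr l k.+1)) addKn.
rewrite [(l + k)%N]addnC -mulrnDr [('C(_, _) + _)%N]addnC -binS.
by rewrite /theta_coef -[in LHS]addSn -[in LHS]addnS bin_inv_fact.
Qed.


Local Notation theta := (ser theta_coef).

(** Antisymmetry of the bracket, applied termwise. *)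
Lemma brsum_swap N (c : nat -> nat -> K) d1 d2 (F G : hom) :
  hom_deg d1 F -> hom_deg d2 G ->
  brsum N c d1 G F = - (sgn K (d1 * d2) *: brsum N (fun k l => c l k) d2 F G).
Proof.
move=> hF hG; rewrite /brsum scaler_sumr -sumrN; apply: eq_bigr => n _.
rewrite scaler_sumr -sumrN [RHS](reindex_inj rev_ord_inj) /=.
apply: eq_bigr => p _; rewrite subSS subKn; last by rewrite -ltnS.
rewrite (lie_anti (adr_iter_deg a_deg _ hG) (adr_iter_deg a_deg _ hF)).
by rewrite scalerN !scalerA mulrC [d2 * d1]mulrC.
Qed.

(** For derivations dl1 and dl2 of a Lie algebra, theta (dl a) is the logarithmic
    derivative e^(-a) dl (e^a), hence the Maurer-Cartan equation.  Here y_i = dl_i a.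
    The scalars c_i and t account for derivations that act from the left
    (c = (-1)^(d f) on degree f) or from the right (c = 1); the condition on t says
    that dl2 - t dl1 is the graded antisymmetrization. *)
Lemma maurer_cartan d1 d2 c1 c2 t (dl1 dl2 : {linear hom -> hom}) (y1 y2 : hom) :
  hom_deg d1 y1 -> hom_deg d2 y2 -> is_local dl1 -> is_local dl2 ->
  (forall G, hom_deg d2 G -> dl1 (adr G) = adr (dl1 G) + c1 *: lie d1 G y1) ->
  (forall G, hom_deg d1 G -> dl2 (adr G) = adr (dl2 G) + c2 *: lie d2 G y2) ->
  t * c1 = c2 * sgn K (d1 * d2) ->
  dl2 (theta y1) - t *: dl1 (theta y2) =
  theta (dl2 y1 - t *: dl1 y2) + c2 *: lie d2 (theta y1) (theta y2).
Proof.
move=> y1_deg y2_deg loc1 loc2 dl1_adr dl2_adr tc; apply: word_ext => w.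
have [N1 hN1] := der_ser y2_deg y1_deg dl1_adr loc1 theta_coef w.
have [N2 hN2] := der_ser y1_deg y2_deg dl2_adr loc2 theta_coef w.
pose N := maxn (maxn N1 N2) (size w).+1.
have e1 := hN1 N _; have e2 := hN2 N _.
rewrite laddE loppE lscaleE e1 ?e2 ?leq_max ?leqnn ?orbT //.
rewrite [in RHS]laddE [in RHS]lscaleE (@lie_ser _ _ _ _ _ _ N) ?leq_maxr //.
rewrite -!(laddE, loppE, lscaleE); congr (GRing.Linear.sort _ (word w)).
rewrite linearB linearZ /=.
rewrite (brsum_swap _ _ y1_deg y2_deg) scalerDr opprD addrACA; congr (_ + _).
rewrite !scalerN opprK !scalerA tc -mulrA sgn_sqr mulr1 -scalerDr.
congr (_ *: _); rewrite -big_split; apply: eq_bigr => n _.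
rewrite -big_split; apply: eq_bigr => p _ /=; rewrite -scalerDl.
by rewrite theta_coefM.
Qed.

End Series.

(** * Constants and derivations of M in the convolution algebra *)

Section ConstAndDer.
Variables (K : fieldType) (M : gradedLie K) (V : gradedSpace K).
Local Notation SV := (SymCoalg V).
Local Notation one := (word [::] : SV).
Local Notation hom := {linear SV -> M}.

Fact const_linear (m : M) : linear (fun z : SV => (counit z : K) *: m).
Proof. by move=> c x y; rewrite linearP scalerDl scalerA. Qed.
(** The element m of M, seen as a function that is constant on A. *)
Definition const (m : M) : hom :=
  HB.pack (fun z : SV => (counit z : K) *: m)
    (GRing.isLinear.Build K SV M _ _ (const_linear m)).

Lemma const_word m w : const m (word w) = (w == [::])%:R *: m.
Proof. by rewrite -counit_word. Qed.

Lemma const_mul m x : const m \oo mul_letter x = 0.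
Proof. by apply: word_ext => w; rewrite /= lmul_word counit_word scale0r. Qed.

Lemma const_deg d m : m \in gdeg M d -> hom_deg d (const m).
Proof.
move=> hm [|x w]; rewrite const_word ?scale0r ?rpred0 //.
by rewrite scale1r /wdeg big_nil addr0.
Qed.

Lemma comp_const (D : {linear M -> M}) m : D \oo const m = const (D m).
Proof. by apply: linear_map_eq => z; rewrite /= linearZ. Qed.

Lemma const_coder d Q m : coderivation d Q -> const m \oo Q = 0.
Proof.
move=> hQ; apply: linear_map_eq => z /=.
by rewrite -[counit _]/((@counit K V \oo Q) z) (counit_coder hQ) scale0r.
Qed.

Definition Ad (m : M) : {linear M -> M} :=
  HB.pack (br m) (GRing.isLinear.Build K M M _ _ (br_linr m)).

(** A constant only sees the empty word, which has degree 0: no sign occurs. *)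
Lemma lie_const e m (F : hom) : lie e (const m) F = Ad m \oo F.
Proof.
apply: word_ext => w; elim: w e F => [|x w IH] e F.
  by rewrite lie_one const_word scale1r.
by rewrite lie_cons const_mul [lie _ 0 _]conv0l linE scaler0 add0r IH /= lmul_word.
Qed.

Lemma comp_lie d D e f (F G : hom) : derivation d D -> hom_deg f F ->
  D \oo lie e F G =
  lie e (D \oo F) G + sgn K (d * f) *: lie (e + d) F (D \oo G).
Proof.
move=> hD hF; apply: word_ext => w.
elim: w e f F G hF => [|x w IH] e f F G hF.
  rewrite linE linE !lie_one /= lie_one.
  exact: (proj2 hD) (hom_deg_one hF).
have compA (H : hom) : (D \oo H) \oo mul_letter x = D \oo (H \oo mul_letter x).
  exact: linear_map_eq.
rewrite laddE lscaleE /= !lie_cons !compA linearD linearZ /=.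
have := IH e _ _ G (hom_deg_mul x hF) => /= ->.
have := IH (e + ldeg x) _ _ (G \oo mul_letter x) hF => /= ->.
rewrite !scalerDr !scalerA addrACA [e + ldeg x + d]addrAC.
congr (_ + _ + (_ *: _ + _)).
by rewrite mulrDl mulrDr !sgnD mulrCA.
Qed.

End ConstAndDer.

(** * The bracket of two generators *)

Section Core.
Variables (K : fieldType) (charK : [pchar K] =i pred0).
Variables (M : gradedLie K) (L A : gradedSubLie M).
Variable P : {linear M -> A}.
Hypothesis P_id : forall a : A, P (sub_val a) = a.
Hypothesis P_ker : forall x : M, P x = 0 <-> x \in L.
Local Notation SV := (SymCoalg A).
Local Notation one := (word [::] : SV).
Local Notation hom := {linear SV -> M}.

Local Notation cst := (@const K M A).

Definition incl : {linear A -> M} := @sub_val K M A.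
(** The generic point of A: the identity of A as a formal function on A. *)
Definition univ : hom := incl \oo @corestr K A.

Lemma univ_word w : univ (word w) = if w is [:: x] then sub_val (lval x) else 0.
Proof.
rewrite /= corestr_word; case: w => [|x [|y w]] //=; exact: (linear0 incl).
Qed.

Lemma univ_one : univ one = 0. Proof. exact: univ_word. Qed.

Lemma univ_deg : hom_deg 0 univ.
Proof.
move=> w; rewrite univ_word add0r; case: w => [|x [|y w]]; rewrite ?rpred0 //.
rewrite /wdeg big_seq1; exact: (valP x).
Qed.

Lemma corestr_deg e z : sym_deg e z -> univ z \in gdeg M e.
Proof.
move=> [s [hs ->]]; rewrite linear_sum big_seq rpred_sum // => c /hs <-.
by rewrite linearZ rpredZ // -[wdeg _]add0r; apply: univ_deg.
Qed.

Definition proj : {linear M -> M} := incl \oo P.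

Lemma proj_A x : x \in A -> proj x = x.
Proof. by move=> xA; rewrite /= -[x]/(sub_val (SubElt xA)) P_id. Qed.
Lemma proj_L x : x \in L -> proj x = 0.
Proof. by move=> /P_ker /= ->; apply: (linear0 incl). Qed.
Lemma projP x : proj x \in A. Proof. exact: sub_valP. Qed.
Lemma proj_compl x : x - proj x \in L.
Proof. by apply/P_ker; rewrite linearB /= P_id subrr. Qed.

Definition valued_in (S : gradedSubLie M) (F : hom) := forall z, F z \in S.

Lemma valued_in_lie S e F G :
  valued_in S F -> valued_in S G -> valued_in S (lie e F G).
Proof.
move=> hF hG z; rewrite -[z]Defs.class_repr class_fsum /fsum linear_sum.
rewrite rpred_sum // => -[c w] _; rewrite linearZ rpredZ //= {z c}.
elim: w e F G hF hG => [|x w IH] e F G hF hG; first by rewrite lie_one gsl_br.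
by rewrite lie_cons rpredD ?rpredZ //; apply: IH => // z; [apply: hF|apply: hG].
Qed.

(** Holds because A is closed under the bracket. *)
Lemma proj_lie_A e (F G : hom) :
  proj \oo lie e (proj \oo F) (proj \oo G) = lie e (proj \oo F) (proj \oo G).
Proof.
apply: linear_map_eq => z; apply: proj_A.
by apply: valued_in_lie => {}z; apply: projP.
Qed.

(** Holds because L is closed under the bracket. *)
Lemma proj_lie_L e (F G : hom) :
  proj \oo lie e (F - proj \oo F) (G - proj \oo G) = 0.
Proof.
apply: linear_map_eq => z; apply: proj_L.
by apply: valued_in_lie => {}z; apply: proj_compl.
Qed.

Lemma proj_comp_stable (E : {linear M -> M}) (F : hom) :
  (forall x, x \in L -> E x \in L) ->
  proj \oo (E \oo F) = proj \oo (E \oo (proj \oo F)).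
Proof.
move=> EL; apply: linear_map_eq => z; apply/eqP; rewrite -subr_eq0.
apply/eqP; have := proj_L (EL _ (proj_compl (F z))).
by rewrite !linearB.
Qed.

Definition bern_coef (k : nat) : K := bernoulli K k / k`!%:R.
Local Notation ser := (ser univ).
Local Notation theta := (ser (@theta_coef K)).
Local Notation bern := (ser bern_coef).

(** The recursion of the Bernoulli numbers says that the two series are inverse. *)
Lemma bern_theta F : bern (theta F) = F.
Proof.
rewrite (ser_ser univ_one) (ser_id univ_one) // => n.
exact: bernoulliP.
Qed.

Lemma theta_bern F : theta (bern F) = F.
Proof.
rewrite (ser_ser univ_one) (ser_id univ_one) // => n.
rewrite -(bernoulliP charK) (reindex_inj rev_ord_inj) /=.
apply: eq_bigr => k _; rewrite subSS mulrC subKn //.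
by rewrite -ltnS.
Qed.

(** Write D = ad m + E.  As theta(R) R = e^R - 1, this is e^R m + theta(R) (E univ):
    the infinitesimal action of the pair at the point e^a, translated back to the
    origin. *)
Definition moment (m : M) (D : {linear M -> M}) : hom :=
  cst m + theta (D \oo univ).

(** Q is the coderivation of degree d attached to the pair (m, D).  Here D contains
    ad m: an element m gives the pair (m, ad m), and a derivation D in Der(M/L) the
    pair (0, D). *)
Record generates (d : int) (m : M) (D : {linear M -> M})
    (Q : {linear SV -> SV}) : Prop := Generates {
  gen_coder : coderivation d Q;
  gen_der : derivation d D;
  gen_deg : m \in gdeg M d;
  gen_L : forall x, x \in L -> D x - br m x \in L;
  gen_taylor : univ \oo Q = bern (proj \oo moment m D)
}.

Section OneGenerator.
Variables (d : int) (m : M) (D : {linear M -> M}) (Q : {linear SV -> SV}).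
Hypothesis gQ : generates d m D Q.

Lemma univ_coder_deg : hom_deg d (univ \oo Q).
Proof.
move=> w; rewrite addrC; apply: corestr_deg; apply: (proj1 (gen_coder gQ)).
exists [:: (1, w)]; split=> [c|]; first by rewrite inE => /eqP ->.
by rewrite big_seq1 scale1r.
Qed.

Lemma der_univ_deg : hom_deg d (D \oo univ).
Proof.
move=> w; rewrite addrC; apply: (proj1 (gen_der gQ)).
by rewrite -[wdeg w]add0r; apply: univ_deg.
Qed.

Lemma moment_deg : hom_deg d (moment m D).
Proof.
apply: hom_degD; first exact: const_deg (gen_deg gQ).
exact: ser_deg univ_deg univ_one _ _ _ der_univ_deg.
Qed.

(** The homogeneity of proj x follows (proj_moment_deg), as Q has degree d. *)
Lemma proj_moment : proj \oo moment m D = theta (univ \oo Q).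
Proof. by rewrite (gen_taylor gQ) theta_bern. Qed.

Lemma proj_moment_deg : hom_deg d (proj \oo moment m D).
Proof. rewrite proj_moment; exact: ser_deg univ_deg univ_one _ _ _ univ_coder_deg. Qed.

Definition precomp_map : {linear hom -> hom} := lprecomp Q.
Definition postcomp_map : {linear hom -> hom} := lcomp D.

Lemma precomp_local : is_local precomp_map.
Proof. by move=> w; exists (Q (word w)). Qed.
Lemma postcomp_local : is_local postcomp_map.
Proof. by move=> w; exists (word w) => F F' /= ->. Qed.

Lemma precomp_adr (G : hom) :
  precomp_map (adr univ G) = adr univ (precomp_map G) + 1 *: lie d G (univ \oo Q).
Proof.
rewrite scale1r [LHS](conv_precomp (gen_coder gQ)) mul0r sgn0 scale1r add0r //.
Qed.

Lemma postcomp_adr f (G : hom) : hom_deg f G ->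
  postcomp_map (adr univ G) =
  adr univ (postcomp_map G) + sgn K (d * f) *: lie d G (D \oo univ).
Proof. by move=> hG; rewrite [LHS](comp_lie _ _ (gen_der gQ) hG) add0r. Qed.

End OneGenerator.

Fact bracket_moment_terms (G : zmodType) (a b c p q r U W : G) :
  a - c - b + (U - W + r) =
  a - b + (U - p) - (c + b + (W + q)) + (b + p + (q + r)).
Proof.
rewrite [RHS]addrACA (addrACA (a - b)) !subrK !opprD -!addrA (addrA (- q)) addNr.
rewrite add0r; congr (_ + _).
by rewrite [RHS]addrCA; congr (_ + _); rewrite addrCA.
Qed.

Section TwoGenerators.
Variables (d1 d2 : int) (m1 m2 : M) (D1 D2 : {linear M -> M}).
Variables (Q1 Q2 : {linear SV -> SV}).
Hypothesis g1 : generates d1 m1 D1 Q1.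
Hypothesis g2 : generates d2 m2 D2 Q2.
Local Notation s := (sgn K (d1 * d2)).
Local Notation x1 := (moment m1 D1).
Local Notation x2 := (moment m2 D2).
Local Notation p1 := (proj \oo x1).
Local Notation p2 := (proj \oo x2).
Local Notation E1 := (D1 - Ad m1).
Local Notation E2 := (D2 - Ad m2).
Local Notation u1 := (theta (D1 \oo univ)).
Local Notation u2 := (theta (D2 \oo univ)).

Lemma comp_subAd (D : {linear M -> M}) m (F : hom) e :
  (D - Ad m) \oo F = D \oo F - lie e (cst m) F.
Proof. by rewrite lie_const; apply: linear_map_eq. Qed.

(** Maurer-Cartan for the commuting derivations F |-> F o Q2 and F |-> D1 o F. *)
Lemma moment_precomp : x1 \oo Q2 = E1 \oo p2 + lie d2 x1 p2.
Proof.
have mc := maurer_cartan univ_deg univ_one charK (der_univ_deg g1)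
  (univ_coder_deg g2) (@postcomp_local D1) (@precomp_local Q2)
  (fun G hG => postcomp_adr g1 hG) (fun G _ => precomp_adr g2 G) (c2 := 1) (t := 1).
have {mc} := mc (congr1 _ (erefl _)).
rewrite !scale1r (_ : precomp_map Q2 (D1 \oo univ) - postcomp_map D1 (univ \oo Q2) = 0).
  rewrite linear0 add0r /= => /eqP; rewrite subr_eq => /eqP mc.
  have -> : x1 \oo Q2 = cst m1 \oo Q2 + u1 \oo Q2.
    exact: (linearD (lprecomp Q2)).
  rewrite (const_coder _ (gen_coder g2)) add0r.
  rewrite [LHS]mc -(proj_moment g2) (comp_subAd _ _ _ d2) /moment lieDl.
  by rewrite [RHS]addrA subrK addrC.
by apply/eqP; rewrite subr_eq0; apply/eqP; apply: linear_map_eq.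
Qed.

(** The bracket of (m1, D1) and (m2, D2).  As D_i contains ad m_i, the sum
    D1 m2 -+ D2 m1 counts [m1, m2] twice, which the last term corrects. *)
Definition bracket_der : {linear M -> M} := gcomm d1 d2 D1 D2.
Definition bracket_elt : M := D1 m2 - s *: D2 m1 - br m1 m2.

Lemma const_sub m m' : cst (m - m') = cst m - cst m'.
Proof. by apply: linear_map_eq => z; rewrite linE /= scalerBr. Qed.
Lemma const_scale c m : cst (c *: m) = c *: cst m.
Proof. by apply: linear_map_eq => z; rewrite linE /= !scalerA mulrC. Qed.

(** Maurer-Cartan for F |-> D1 o F and F |-> D2 o F.  Both act from the left, hence
    t = c1 = c2 = s. *)
Lemma theta_bracket :
  theta (bracket_der \oo univ) = D1 \oo u2 - s *: (D2 \oo u1) + lie d2 u1 u2.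
Proof.
have D2_adr (G : hom) (hG : hom_deg d1 G) := postcomp_adr g2 hG.
rewrite [d2 * d1]mulrC in D2_adr.
have mc := maurer_cartan univ_deg univ_one charK (der_univ_deg g1)
  (der_univ_deg g2) (@postcomp_local D1) (@postcomp_local D2)
  (fun G hG => postcomp_adr g1 hG) D2_adr (t := s).
have {mc} /= := mc erefl.
move/(congr1 (fun F : hom => - (s *: F))).
rewrite scalerBr scalerDr !scalerA sgn_sqr !scale1r opprB opprD => mc.
rewrite mc addrNK -linearZ -linearN.
congr (ser _ _); apply: linear_map_eq => z.
by rewrite /= /gcomm scalerBr scalerA sgn_sqr scale1r opprB.
Qed.

(** The moments satisfy the structure equation of the semidirect product: the terms
    [m1, theta (D2 univ)] and [theta (D1 univ), m2] come from D_i = E_i + ad m_i. *)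
Lemma bracket_moment :
  moment bracket_elt bracket_der =
  E1 \oo x2 - s *: (E2 \oo x1) + lie d2 x1 x2.
Proof.
rewrite {1}/moment theta_bracket.
have c1_deg := const_deg (V := A) (gen_deg g1).
have c2_deg := const_deg (V := A) (gen_deg g2).
have u1_deg : hom_deg d1 u1.
  exact: ser_deg univ_deg univ_one _ _ _ (der_univ_deg g1).
have E1x2 : E1 \oo x2 = cst (D1 m2) - cst (br m1 m2) +
    (D1 \oo u2 - lie d2 (cst m1) u2).
  by rewrite -comp_subAd /moment linearD /= comp_const /= -const_sub.
have E2x1 : E2 \oo x1 = cst (D2 m1) + s *: cst (br m1 m2) +
    (D2 \oo u1 + s *: lie d2 u1 (cst m2)).
  have := lie_anti c2_deg u1_deg; rewrite [d2 * d1]mulrC => /eqP.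
  rewrite eq_sym eqr_oppLR => /eqP ->; rewrite -comp_subAd.
  rewrite -const_scale /moment linearD /= comp_const; congr (_ + _).
  rewrite /= (br_anti (gen_deg g2) (gen_deg g1)) opprK [d2 * d1]mulrC.
  by apply: linear_map_eq => z; rewrite linE /= scalerDr.
rewrite E1x2 E2x1 !scalerDr !scalerA sgn_sqr !scale1r.
rewrite -[lie d2 x1 x2]/(lie d2 (cst m1 + u1) (cst m2 + u2)) lieDl !lieDr [lie _ (cst _) (cst _)]lie_const.
rewrite comp_const -bracket_moment_terms; congr (_ + _).
by rewrite /bracket_elt !const_sub const_scale.
Qed.

End TwoGenerators.

(** Expand proj [F - proj F, G - proj G] = 0. *)
Lemma proj_lie_moment e (F G : hom) :
  proj \oo lie e F G =
  proj \oo lie e F (proj \oo G) + proj \oo lie e (proj \oo F) G -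
  lie e (proj \oo F) (proj \oo G).
Proof.
apply/eqP; rewrite -subr_eq0 -(proj_lie_L e F G) lieBl !lieBr !(linearB (lcomp proj)) /=.
by rewrite proj_lie_A; apply/eqP; rewrite -[RHS]addrA -opprD [in RHS]addrA.
Qed.

Section Homomorphism.
Variables (d1 d2 : int) (m1 m2 : M) (D1 D2 : {linear M -> M}).
Variables (Q1 Q2 : {linear SV -> SV}).
Hypothesis g1 : generates d1 m1 D1 Q1.
Hypothesis g2 : generates d2 m2 D2 Q2.
Local Notation s := (sgn K (d1 * d2)).
Local Notation x1 := (moment m1 D1).
Local Notation x2 := (moment m2 D2).
Local Notation p1 := (proj \oo x1).
Local Notation p2 := (proj \oo x2).

(** The only place where the decomposition of M matters: with l_i = x_i - proj x_i,
    the brackets [l_1, l_2] project to 0, the brackets [p_1, p_2] to themselves, and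
    the maps E_i only see p_i modulo L. *)
Lemma proj_precomp_bracket :
  p1 \oo Q2 - s *: (p2 \oo Q1) - lie d2 p1 p2 =
  proj \oo moment (bracket_elt d1 d2 m1 m2 D1 D2) (bracket_der d1 d2 D1 D2).
Proof.
have p_precomp e m m' D D' (Q : {linear SV -> SV}) :
    moment m D \oo Q = (D - Ad m) \oo (proj \oo moment m' D') +
      lie e (moment m D) (proj \oo moment m' D') ->
    (forall x, x \in L -> D x - br m x \in L) ->
    (proj \oo moment m D) \oo Q = proj \oo ((D - Ad m) \oo moment m' D') +
      proj \oo lie e (moment m D) (proj \oo moment m' D').
  move=> xQ EL; rewrite (@proj_comp_stable (D - Ad m)) //.
  transitivity (proj \oo (moment m D \oo Q)); first exact: linear_map_eq.
  by rewrite xQ; apply: (linearD (lcomp proj)).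
rewrite (p_precomp _ _ _ _ _ _ (moment_precomp g1 g2) (gen_L g1)).
rewrite (p_precomp _ _ _ _ _ _ (moment_precomp g2 g1) (gen_L g2)).
have := lie_anti (moment_deg g2) (proj_moment_deg g1); rewrite [d2 * d1]mulrC => ->.
have projNZ c (F : hom) : proj \oo (- (c *: F)) = - (c *: (proj \oo F)).
  by rewrite (linearN (lcomp proj)) (linearZZ (lcomp proj)).
have projDBZ c (F G H : hom) :
    proj \oo (F - c *: G + H) = proj \oo F - c *: (proj \oo G) + proj \oo H.
  by rewrite (linearD (lcomp proj)) (linearD (lcomp proj)) /= projNZ.
rewrite (bracket_moment g1 g2) projNZ projDBZ [proj \oo lie d2 x1 x2]proj_lie_moment.
rewrite scalerDr scalerN scalerA sgn_sqr scale1r opprD opprK addrACA.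
by rewrite -!addrA.
Qed.

(** Maurer-Cartan for F |-> F o Q1 and F |-> F o Q2. *)
Lemma univ_bracket :
  univ \oo (gcomm d1 d2 Q1 Q2 : {linear SV -> SV}) =
  bern (proj \oo moment (bracket_elt d1 d2 m1 m2 D1 D2) (bracket_der d1 d2 D1 D2)).
Proof.
rewrite -proj_precomp_bracket (proj_moment g1) (proj_moment g2).
have mc := maurer_cartan univ_deg univ_one charK (univ_coder_deg g1)
  (univ_coder_deg g2) (@precomp_local Q1) (@precomp_local Q2)
  (fun G _ => precomp_adr g1 G) (fun G _ => precomp_adr g2 G) (t := s).
have {mc} /= := mc (mulrC _ _); rewrite scale1r => ->; rewrite addrK bern_theta.
by apply: linear_map_eq => z; rewrite /= /gcomm linearB linearZ.
Qed.

End Homomorphism.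

Lemma univ_inj (Q Q' : {linear SV -> SV}) w :
  univ \oo Q = univ \oo Q' -> corestr (Q (word w)) = corestr (Q' (word w)).
Proof.
by move/(congr1 (fun F : hom => F (word w))) => h; apply: val_inj.
Qed.

(** Two coderivations with the same corestriction coincide. *)
Theorem generator_bracket d1 d2 m1 m2 (D1 D2 : {linear M -> M})
    (Q1 Q2 Q : {linear SV -> SV}) m (D : {linear M -> M}) :
  generates d1 m1 D1 Q1 -> generates d2 m2 D2 Q2 ->
  coderivation (d1 + d2) Q -> univ \oo Q = bern (proj \oo moment m D) ->
  m = D1 m2 - sgn K (d1 * d2) *: D2 m1 - br m1 m2 ->
  D =1 gcomm d1 d2 D1 D2 ->
  gcomm d1 d2 Q1 Q2 =1 Q.
Proof.
move=> g1 g2 hQ Qt m_eq D_eq.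
suff /(congr1 (fun F : {linear SV -> SV} => F : SV -> SV)) eqQ :
    (gcomm d1 d2 Q1 Q2 : {linear SV -> SV}) = Q by move=> z; rewrite -eqQ.
apply: (coderivation_ext charK _ hQ).
  exact: coderivation_gcomm (gen_coder g1) (gen_coder g2).
move=> w; apply: univ_inj; rewrite (univ_bracket g1 g2) Qt m_eq.
by congr (bern (_ \oo moment _ _)); apply: linear_map_eq => x; rewrite D_eq.
Qed.

End Core.

(** * Symmetrized iterated brackets *)

(** Permutations with a prescribed value at i come from permutations on one letter
    fewer; the inverse removes i from the source and j from the target. *)
Lemma lift_perm_onto n (i j : 'I_n.+1) :
  {on [pred s : 'S_n.+1 | s i == j], bijective (lift_perm i j)}.
Proof.
pose ulsf i (s : 'S_n.+1) k := odflt k (unlift (s i) (s (lift i k))).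
have ulsfK i' (s : 'S_n.+1) k : lift (s i') (ulsf i' s k) = s (lift i' k).
  rewrite /ulsf; have:= neq_lift i' k.
  by rewrite -(can_eq (permK s)) => /unlift_some[] ? ? ->.
have inj_ulsf : injective (ulsf i _).
  move=> s; apply: can_inj (ulsf (s i) s^-1%g) _ => k'.
  by rewrite {1}/ulsf ulsfK !permK liftK.
exists (fun s => perm (inj_ulsf s)) => [s _ | s].
  by apply/permP=> k'; rewrite permE /ulsf lift_perm_lift lift_perm_id liftK.
move/(s _ =P _) => si0; apply/permP=> k.
case: (unliftP i k) => [k'|] ->; rewrite ?lift_perm_id //.
by rewrite lift_perm_lift -si0 permE ulsfK.
Qed.

Section Koszul.
Variable K : fieldType.

(** The sign of moving letter j to the end of a word. *)
Definition end_sign n (d : 'I_n.+1 -> int) (j : 'I_n.+1) : K :=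
  \prod_(l < n.+1 | (j < l)%N) sgn K (d l * d j).

(** An inversion of a permutation with last value j either does not involve the
    last position, or pairs it with a letter that follows j. *)
Lemma koszul_lift_perm n (d : 'I_n.+1 -> int) j (t : 'S_n) :
  koszul K d (lift_perm ord_max j t) =
  end_sign d j * koszul K (fun i => d (lift j i)) t.
Proof.
have lift_widen (i : 'I_n) : widen_ord (leqnSn n) i = lift ord_max i.
  by apply: val_inj; rewrite /= /bump leqNgt ltn_ord add0n.
have lift_lt (i k : 'I_n) : (lift j i < lift j k)%N = (i < k)%N.
  by rewrite !ltnNge /= leq_bump2.
rewrite /koszul big_ord_recr /= [X in _ * X]big1 ?mulr1 => [|k /andP[]]; last first.
  by rewrite ltnNge -ltnS ltn_ord.
have -> : end_sign d j = \prod_(i < n)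
    (if (j < lift j (t i))%N then sgn K (d (lift j (t i)) * d j) else 1).
  rewrite /end_sign big_mkcond (bigD1_ord j) //= ltnn mul1r.
  exact: (reindex_inj (@perm_inj _ t)).
rewrite -big_split; apply: eq_bigr => i _ /=.
rewrite lift_widen big_mkcond big_ord_recr /= lift_perm_id lift_perm_lift mulrC.
congr (_ * _).
  by rewrite ltn_ord.
rewrite [RHS]big_mkcond; apply: eq_bigr => k _.
by rewrite lift_widen !lift_perm_lift lift_lt.
Qed.

End Koszul.

Section Symmetrization.
Variables (K : fieldType) (M : gradedLie K) (A : gradedSubLie M).
Local Notation SV := (SymCoalg A).
Local Notation one := (word [::] : SV).
Local Notation hom := {linear SV -> M}.
Local Notation univ := (univ A).
Implicit Types (H : seq M -> M) (F : hom).

Definition letters n (x : 'I_n -> letter A) := [seq x i | i <- enum 'I_n].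
Definition values n (x : 'I_n -> letter A) := [seq sub_val (lval (x i)) | i <- enum 'I_n].

Definition symmetrize n (x : 'I_n -> letter A) H : M :=
  \sum_(s : 'S_n) koszul K (fun i => ldeg (x i)) s *: H (values (x \o s)).

(** F is the symmetrization of the rule H, which reads the letters in a fixed
    order. *)
Definition represents H F := forall n (x : 'I_n -> letter A),
  F (word (letters x)) = symmetrize x H.

Lemma letters_recl n (x : 'I_n.+1 -> letter A) :
  letters x = x ord0 :: letters (x \o lift ord0).
Proof. by rewrite /letters enum_ordSl /= -map_comp. Qed.

Lemma values_recr n (x : 'I_n.+1 -> letter A) :
  values x = rcons (values (x \o lift ord_max)) (sub_val (lval (x ord_max))).
Proof.
rewrite /values enum_ordSr map_rcons -map_comp; congr rcons.
apply: eq_map => i /=; congr (sub_val (lval (x _))); apply: val_inj.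
by rewrite /= /bump leqNgt ltn_ord add0n.
Qed.

Lemma size_values n (x : 'I_n -> letter A) : size (values x) = n.
Proof. by rewrite size_map size_enum_ord. Qed.

Lemma eq_symmetrize n (x : 'I_n -> letter A) H H' :
  (forall s, size s = n -> H s = H' s) -> symmetrize x H = symmetrize x H'.
Proof. by move=> eqH; apply: eq_bigr => s _; rewrite eqH ?size_values. Qed.

(** Sort the permutations by the letter j that they put last. *)
Lemma symmetrize_last n (x : 'I_n.+1 -> letter A) H H' :
  (forall s y, H' (rcons s y) = br (H s) y) ->
  symmetrize x H' = \sum_(j < n.+1) end_sign K (fun i => ldeg (x i)) j *:
     br (symmetrize (x \o lift j) H) (sub_val (lval (x j))).
Proof.
move=> H'E; rewrite /symmetrize (partition_big (fun s : 'S_n.+1 => s ord_max) xpredT) //=.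
apply: eq_bigr => j _; rewrite (reindex _ (lift_perm_onto ord_max j)) /=.
rewrite (eq_bigl xpredT) => [|t]; last by rewrite lift_perm_id eqxx.
rewrite -[br _ _]/(lie_bilinear M _ _).
pose brj : {linear M -> M} := HB.pack (fun z => br z (sub_val (lval (x j))))
  (GRing.isLinear.Build K M M _ _ (br_linl _)).
rewrite -[lie_bilinear _ _ _]/(brj _) linear_sum scaler_sumr.
apply: eq_bigr => t _; rewrite linearZ scalerA koszul_lift_perm; congr (_ *: _).
rewrite values_recr H'E /= lift_perm_id; congr (br (H _) _).
by apply: eq_map => i /=; rewrite lift_perm_lift.
Qed.

Lemma lie_const_r e F m w :
  lie e F (const A m) (word w) = sgn K (e * wdeg w) *: br (F (word w)) m.
Proof.
elim: w e F => [|x w IH] e F.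
  by rewrite lie_one const_word scale1r /wdeg big_nil mulr0 scale1r.
rewrite lie_cons const_mul IH [lie _ _ 0]conv0r linE addr0 /= lmul_word scalerA.
by rewrite wdeg_cons mulrDr sgnD.
Qed.

Lemma univ_mul_letter x : univ \oo mul_letter x = const A (sub_val (lval x)).
Proof.
apply: word_ext => w; rewrite const_word /= lmul_word -[LHS]/(univ (word (x :: w))).
by rewrite univ_word; case: w => [|y w]; rewrite ?scale1r ?scale0r.
Qed.

Lemma adr_univ_cons F x w :
  adr univ F (word (x :: w)) = adr univ (F \oo mul_letter x) (word w) +
    sgn K (ldeg x * wdeg w) *: br (F (word w)) (sub_val (lval x)).
Proof.
rewrite -lie_const_r -univ_mul_letter [LHS]lie_cons mul0r sgn0 scale1r add0r.
by [].
Qed.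

Lemma adr_univ_one F : adr univ F one = 0.
Proof. by rewrite [LHS]lie_one univ_one; apply: (bmap0r (lie_bilinear M)). Qed.

Lemma sgn_sum (I : Type) (r : seq I) (f : I -> int) :
  sgn K (\sum_(i <- r) f i) = \prod_(i <- r) sgn K (f i).
Proof. exact: (big_morph (sgn K) (@sgnD K) (sgn0 K)). Qed.

(** The generic point only sees words of length one, so bracketing with it pulls
    each letter in turn to the end of the word. *)
Lemma adr_univ_letters n (x : 'I_n.+1 -> letter A) F :
  adr univ F (word (letters x)) =
  \sum_(j < n.+1) end_sign K (fun i => ldeg (x i)) j *:
     br (F (word (letters (x \o lift j)))) (sub_val (lval (x j))).
Proof.
elim: n x F => [|n IH] x F; rewrite letters_recl adr_univ_cons.
  rewrite {1}/letters enum_ord0 adr_univ_one add0r big_ord_recl big_ord0 addr0.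
  rewrite /letters enum_ord0 /wdeg big_nil mulr0 /end_sign big1 // => i.
  by rewrite [i]ord1.
rewrite big_ord_recl addrC; congr (_ *: _ + _).
  rewrite /end_sign big_mkcond big_ord_recl /= mul1r.
  rewrite /wdeg /letters big_map mulr_sumr sgn_sum big_enum.
  by apply: eq_bigr => i _; rewrite mulrC.
rewrite IH; apply: eq_bigr => j _; congr (_ *: br _ _).
  rewrite /end_sign [RHS]big_mkcond [RHS]big_ord_recl /= mul1r -big_mkcond.
  by apply: eq_bigl => i; rewrite /= /bump !add1n ltnS.
rewrite /= lmul_word letters_recl /=; congr (F (word (x _ :: _))).
  exact: val_inj.
apply: eq_map => i /=; congr x; apply: val_inj.
by rewrite /= bumpS.
Qed.

(** Both sides obey the same recursion on the last letter: this is the dictionary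
    between sums over permutations and powers of R. *)
Lemma represents_adr H H' F : represents H F ->
  H' [::] = 0 -> (forall s y, H' (rcons s y) = br (H s) y) ->
  represents H' (adr univ F).
Proof.
move=> HF H'0 H'E [|n] x.
  rewrite {1}/letters enum_ord0 adr_univ_one /symmetrize big1 // => s _.
  by rewrite {1}/values enum_ord0 H'0 scaler0.
rewrite adr_univ_letters (symmetrize_last _ H'E).
by apply: eq_bigr => j _; rewrite HF.
Qed.

Definition right_br H (s : seq M) : M :=
  if s is _ :: _ then br (H (take (size s).-1 s)) (last 0 s) else 0.

Lemma right_br_rcons H s y : right_br H (rcons s y) = br (H s) y.
Proof.
rewrite /right_br size_rcons last_rcons -cats1 take_size_cat //.
by case: s.
Qed.

Lemma represents_adr_iter k H F : represents H F ->
  represents (iter k right_br H) (adr_iter univ k F).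
Proof.
by move=> HF; elim: k => //= k IH; apply: represents_adr IH _ _ => // s y; apply: right_br_rcons.
Qed.

Lemma iter_right_br k H s :
  iter k right_br H s =
  if (k <= size s)%N then iter_br (H (take (size s - k) s)) (drop (size s - k) s)
  else 0.
Proof.
elim: k s => [|k IH] s; first by rewrite subn0 take_size drop_size.
case/lastP: s => [|s y] //.
rewrite iterS right_br_rcons IH size_rcons ltnS subSS.
case: ifP => hk; last exact: (bmap0l (lie_bilinear M)).
have le_s : (size s - k <= size s)%N by apply: leq_subr.
rewrite -cats1 takel_cat // drop_cat; case: ltnP => h.
  by rewrite /iter_br foldl_cat.
by rewrite [in RHS](eqP (_ : size s - k - size s == 0)%N) ?subn_eq0 // drop_oversize.
Qed.

Lemma represents_ser (c : nat -> K) H F : represents H F ->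
  represents (fun s => \sum_(k < (size s).+1) c k *: iter k right_br H s)
    (ser univ c F).
Proof.
move=> HF n x; rewrite ser_wser /wser.
have -> : size (letters x) = n by rewrite size_map size_enum_ord.
transitivity (symmetrize x (fun s => \sum_(k < n.+1) c k *: iter k right_br H s)).
  rewrite /symmetrize; under [RHS]eq_bigr do rewrite scaler_sumr.
  rewrite exchange_big; apply: eq_bigr => k _.
  rewrite (represents_adr_iter k HF) /symmetrize scaler_sumr.
  by apply: eq_bigr => s _; rewrite !scalerA mulrC.
by apply: eq_symmetrize => s ->.
Qed.

Lemma represents_comp (D : {linear M -> M}) H F :
  represents H F -> represents (D \o H) (D \oo F).
Proof.
move=> HF n x; rewrite /= HF linear_sum.
by apply: eq_bigr => s _; rewrite linearZ.
Qed.

Lemma representsD H H' F F' : represents H F -> represents H' F' ->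
  represents (fun s => H s + H' s) (F + F').
Proof.
move=> HF HF' n x; rewrite linE HF HF' -big_split.
by apply: eq_bigr => s _; rewrite /= scalerDr.
Qed.

Lemma symmetrize0 (x : 'I_0 -> letter A) H : symmetrize x H = H [::].
Proof.
rewrite /symmetrize (big_pred1 1%g) => [|s]; last first.
  by apply/esym/eqP/permP => -[].
by rewrite /koszul big_ord0 scale1r /values enum_ord0.
Qed.

Lemma symmetrize1 (x : 'I_1 -> letter A) H :
  symmetrize x H = H [:: sub_val (lval (x ord0))].
Proof.
rewrite /symmetrize (big_pred1 1%g) => [|s]; last first.
  by apply/esym/eqP/permP => i; rewrite [s i]ord1 [X in _ = X]ord1.
rewrite /koszul big_ord_recl big_ord0 mulr1 big1 ?scale1r => [|k]; last first.
  by rewrite [k]ord1.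
by rewrite /values enum_ordSl enum_ord0 /= perm1.
Qed.

Lemma represents_const m : represents (fun s => if s is [::] then m else 0) (const A m).
Proof.
move=> [|n] x; first by rewrite symmetrize0 /letters enum_ord0 const_word scale1r.
rewrite letters_recl const_word scale0r /symmetrize big1 // => s _.
by rewrite /values enum_ordSl /= scaler0.
Qed.

Lemma represents_univ : represents (fun s => if s is [:: y] then y else 0) univ.
Proof.
move=> [|[|n]] x.
- by rewrite symmetrize0 /letters enum_ord0 univ_word.
- by rewrite symmetrize1 letters_recl {1}/letters enum_ord0 univ_word.
rewrite !letters_recl univ_word /symmetrize big1 // => s _.
by rewrite /values !enum_ordSl /= scaler0.
Qed.

End Symmetrization.

(** * The Taylor coefficients of Phi *)

Section Identification.
Variables (K : fieldType) (charK : [pchar K] =i pred0).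
Variables (M : gradedLie K) (L A : gradedSubLie M) (P : {linear M -> A}).
Local Notation SV := (SymCoalg A).

Lemma iter_brZ c (z : M) s : iter_br (c *: z) s = c *: iter_br z s.
Proof.
elim: s z => //= y s IH z.
have e : br (c *: z) y = c *: br z y := bmapZl (lie_bilinear M) c z y.
by rewrite /iter_br /= e; apply: IH.
Qed.

Lemma iter_br0 s : iter_br (0 : M) s = 0.
Proof. by rewrite -{1}(scale0r (0 : M)) iter_brZ scale0r. Qed.

Lemma eq_represents (H H' : seq M -> M) (F : {linear SV -> M}) :
  H =1 H' -> represents H F -> represents H' F.
Proof.
by move=> HH' HF n x; rewrite HF; apply: eq_symmetrize => s _; apply: HH'.
Qed.

Definition moment_rule (m : M) (D : M -> M) (s : seq M) : M :=
  if s is y :: u then ((size s)`!%:R)^-1 *: iter_br (D y) u else m.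

Lemma represents_moment m (D : {linear M -> M}) :
  represents (moment_rule m D) (moment A m D).
Proof.
pose rule (s : seq M) := if s is [:: y] then y else 0.
have rule0 s : size s != 1%N -> rule s = 0 by case: s => [|y [|z s]].
have hrep := representsD (@represents_const K M A m)
  (represents_ser (@theta_coef K) (represents_comp D (@represents_univ K M A))).
apply: (eq_represents _ hrep) => -[|y u].
  by rewrite big_ord_recl big_ord0 /= linear0 scaler0 !addr0.
have lt_u : (size u < (size (y :: u)).+1)%N by rewrite /= ltnW.
(* D univ has length one, so only the power of R that uses up u contributes. *)
rewrite add0r (bigD1 (Ordinal lt_u)) //= big1 ?addr0 => [|k neq_k].
  by rewrite iter_right_br /= leqnSn subSnn /= take0 drop0.
rewrite iter_right_br -/rule; case: ifP => [le_k|]; last by rewrite scaler0.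
rewrite /= rule0 ?linear0 ?iter_br0 ?scaler0 // size_takel ?leq_subr //.
apply: contra neq_k => /eqP e; apply/eqP/val_inj => /=.
by have := subnK le_k; rewrite e add1n => -[].
Qed.

Definition taylor_rule (m : M) (D : M -> M) (s : seq M) : M :=
  \sum_(0 <= k < (size s).+1) bern_coef K (size s - k) *:
    iter_br (sub_val (P (moment_rule m D (take k s)))) (drop k s).

Lemma represents_taylor m (D : {linear M -> M}) :
  represents (taylor_rule m D) (ser (univ A) (bern_coef K) (proj P \oo moment A m D)).
Proof.
have hrep := represents_ser (bern_coef K) (represents_comp (proj P)
  (represents_moment m D)).
apply: (eq_represents _ hrep) => s.
rewrite /taylor_rule big_mkord (reindex_inj rev_ord_inj) /=.
apply: eq_bigr => k _; rewrite subSS iter_right_br leq_subr subKn //.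
by rewrite -ltnS.
Qed.

(** A coderivation whose Taylor coefficients are the symmetrized taylor_rule has the
    corestriction required by generates. *)
Lemma univ_precompE (m : M) (D : {linear M -> M}) (Q : {linear SV -> SV}) :
  (forall w, sub_val (taylor Q w) = sym_sum w (taylor_rule m D)) ->
  univ A \oo Q = ser (univ A) (bern_coef K) (proj P \oo moment A m D).
Proof.
move=> hQ; apply: word_ext => w; rewrite -{2}[w](map_tnth_enum (in_tuple w)).
rewrite (represents_taylor m D); exact: hQ.
Qed.

Lemma taylor_term c (m : M) (D : M -> M) s k : (0 < k)%N -> (k <= size s)%N ->
  c *: iter_br (sub_val (P (moment_rule m D (take k s)))) (drop k s) =
  (c / k`!%:R) *: iter_br
     (sub_val (P (iter_br (D (head 0 s)) (take k.-1 (behead s))))) (drop k s).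
Proof.
case: s => [|y s]; first by case: k.
case: k => // k _ lek; rewrite /= size_takel //.
rewrite linearZ -[sub_val _]/(incl A (_ *: _)) linearZ iter_brZ scalerA.
by [].
Qed.

Lemma derivation_gcomm d1 d2 (D1 D2 : {linear M -> M}) :
  derivation d1 D1 -> derivation d2 D2 ->
  derivation (d1 + d2) (gcomm d1 d2 D1 D2).
Proof.
move=> h1 h2; split=> [e x hx|e x y hx].
  rewrite /= /gcomm -scaleNr rpredD ?rpredZ //; last by rewrite addrA; apply/(proj1 h2)/(proj1 h1).
  by rewrite [d1 + d2]addrC addrA; apply/(proj1 h1)/(proj1 h2).
have brBl c u v : br (u - c *: v) y = br u y - c *: br v y.
  by have := br_linl y (- c) v u; rewrite !scaleNr ![- _ + _]addrC.
have brBr c u v : br x (u - c *: v) = br x u - c *: br x v.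
  by have := br_linr x (- c) v u; rewrite !scaleNr ![- _ + _]addrC.
rewrite /= /gcomm (proj2 h1 _ _ _ hx) (proj2 h2 _ _ _ hx).
rewrite (linearD D1) (linearD D2) (linearZZ D1) (linearZZ D2).
rewrite !(proj2 h1 _ _ _ hx) !(proj2 h2 _ _ _ hx).
rewrite (proj2 h1 _ _ _ (proj1 h2 _ _ hx)) (proj2 h2 _ _ _ (proj1 h1 _ _ hx)).
rewrite brBl brBr scalerBr !scalerDr !scalerA.
rewrite -(cross_terms_cancel _ (sgn K (d1 * (e + d2)) *: br (D2 x) (D1 y))
  (sgn K (d2 * e) *: br (D1 x) (D2 y))).
congr (_ + _ + (_ + _ *: _) - (_ + _ *: _ + (_ *: _ + _ *: _))).
- by rewrite mulrDl sgnD mulrC.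
- by rewrite mulrDr sgnD [d2 * d1]mulrC mulrCA sgn_sqr mulr1.
- by rewrite mulrDr sgnD mulrC.
by rewrite mulrDl sgnD [RHS]mulrC mulrA.
Qed.

Lemma der_pres_gcomm d1 d2 (D1 D2 : {linear M -> M}) :
  der_pres L d1 D1 -> der_pres L d2 D2 ->
  der_pres L (d1 + d2) (gcomm d1 d2 D1 D2).
Proof.
move=> [h1 L1] [h2 L2]; split=> [|x Lx]; first exact: derivation_gcomm.
by rewrite /= /gcomm -scaleNr rpredD ?rpredZ //; [apply/L1/L2|apply/L2/L1].
Qed.

Lemma phi_coefE i k : phi_coef K i k = bern_coef K (i - k) / k`!%:R.
Proof.
by rewrite /phi_coef /bern_coef natrM invfM mulrA mulrAC.
Qed.

Lemma Ad_derivation d m : m \in gdeg M d -> derivation d (Ad m).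
Proof.
move=> hm; split=> [e x hx|e x y hx]; first by rewrite addrC; apply: br_deg.
exact: br_jacobi.
Qed.

Lemma bern_coef0 : bern_coef K 0 = 1.
Proof. by have := bernoulliP charK 0; rewrite big_ord1 divr1. Qed.

(** The summand k = 0, where the bracket with m is empty, is the constant part of the
    moment; the summands k >= 1 are those of the derivation ad m. *)
Lemma generates_elt d m Q : m \in gdeg M d -> is_Phi_elt P d m Q ->
  generates L P d m (Ad m) Q.
Proof.
move=> hm [hQ tQ]; split=> //; first exact: Ad_derivation.
  by move=> x _; rewrite subrr rpred0.
apply: univ_precompE => w; rewrite tQ.
case: w => [|x w].
  have -> : sym_sum ([::] : seq (letter A)) (taylor_rule m (Ad m)) =
      taylor_rule m (Ad m) [::] by exact: symmetrize0.
  by rewrite /taylor_rule big_nat1 bern_coef0 scale1r.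
apply: eq_symmetrize => s sz_s; rewrite /taylor_rule sz_s.
apply: eq_big_nat => -[_|k lek]; rewrite phi_coefE.
  by rewrite take0 /= fact0 divr1.
by rewrite taylor_term ?sz_s //; case: s sz_s.
Qed.

Lemma generates_der d (D : {linear M -> M}) Q : der_pres L d D ->
  is_Phi_der P d D Q -> generates L P d 0 D Q.
Proof.
move=> [hD DL] [hQ tQ]; split=> //; first exact: rpred0.
  by move=> x /DL; rewrite [br 0 x](bmap0l (lie_bilinear M)) subr0.
apply: univ_precompE => w; rewrite tQ; apply: eq_symmetrize => s sz_s.
rewrite /taylor_rule [RHS]big_ltn // take0 /= linear0.
rewrite [sub_val 0](linear0 (incl A)) iter_br0 scaler0 add0r sz_s.
apply: eq_big_nat => k /andP[k_gt0 lek].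
by rewrite phi_coefE taylor_term // sz_s.
Qed.

End Identification.

Theorem theorem1p2 (K : fieldType) (charK : [pchar K] =i pred0)
  (M : gradedLie K) (L A : gradedSubLie M)
  (LA_sum : forall x : M, exists l a : M,
     [/\ l \in L, a \in A & x = l + a])
  (LA_cap : forall x : M, x \in L -> x \in A -> x = 0)
  (P : {linear M -> A})
  (P_id : forall a : A, P (sub_val a) = a)
  (P_ker : forall x : M, P x = 0 <-> x \in L)
  (PhiM : M -> {linear SymCoalg A -> SymCoalg A})
  (PhiM_def : forall (d : int) (m : M),
     m \in gdeg M d -> is_Phi_elt P d m (PhiM m))
  (PhiD : {linear M -> M} -> {linear SymCoalg A -> SymCoalg A})
  (PhiD_def : forall (d : int) (D : {linear M -> M}),
     der_pres L d D -> is_Phi_der P d D (PhiD D)) :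
  [/\ forall (d1 d2 : int) (m1 m2 : M),
        m1 \in gdeg M d1 -> m2 \in gdeg M d2 ->
        gcomm d1 d2 (PhiM m1) (PhiM m2) =1 PhiM (br m1 m2),
      forall (d1 d2 : int) (D1 D2 : {linear M -> M}),
        der_pres L d1 D1 -> der_pres L d2 D2 ->
        gcomm d1 d2 (PhiD D1) (PhiD D2) =1 PhiD (gcomm d1 d2 D1 D2)
    & forall (d e : int) (D : {linear M -> M}) (m : M),
        der_pres L d D -> m \in gdeg M e ->
        gcomm d e (PhiD D) (PhiM m) =1 PhiM (D m)].
Proof.
have genM d m (hm : m \in gdeg M d) :=
  generates_elt charK L hm (PhiM_def d m hm).
have genD d D (hD : der_pres L d D) := generates_der hD (PhiD_def d D hD).
have core d1 d2 m1 m2 D1 D2 Q1 Q2 m D Q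
    (g1 : generates L P d1 m1 D1 Q1) (g2 : generates L P d2 m2 D2 Q2)
    (g : generates L P (d1 + d2) m D Q) :=
  generator_bracket charK P_id P_ker g1 g2 (gen_coder g) (gen_taylor g).
split.
- move=> d1 d2 m1 m2 h1 h2.
  have h12 := br_deg h1 h2.
  apply: (core _ _ _ _ _ _ _ _ _ _ _ (genM _ _ h1) (genM _ _ h2) (genM _ _ h12)).
    have /= -> := br_anti h2 h1.
    by rewrite scalerN opprK scalerA mulrC [d2 * d1]mulrC sgn_sqr scale1r addrK.
  move=> x; rewrite /gcomm /= (br_jacobi x h1 h2).
  by rewrite addrK.
- move=> d1 d2 D1 D2 h1 h2.
  have h12 : der_pres L (d1 + d2) (gcomm d1 d2 D1 D2).
    exact: der_pres_gcomm.
  apply: (core _ _ _ _ _ _ _ _ _ _ _ (genD _ _ h1) (genD _ _ h2) (genD _ _ h12)) => //.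
  by rewrite (linear0 D1) (linear0 D2) scaler0 [br 0 0](bmap0l (lie_bilinear M)) !subr0.
- move=> d e D m hD hm.
  have hDm : D m \in gdeg M (d + e) by rewrite addrC; apply: (proj1 (proj1 hD)).
  apply: (core _ _ _ _ _ _ _ _ _ _ _ (genD _ _ hD) (genM _ _ hm) (genM _ _ hDm)).
    by rewrite (linear0 (Ad m)) scaler0 [br 0 _](bmap0l (lie_bilinear M)) !subr0.
  move=> x; rewrite /gcomm /= (proj2 (proj1 hD) _ _ _ hm).
  by rewrite addrK.
Qed.
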